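(* Fix a device $n$ and a frame $t$, and consider the probabilistic model given in the context. Let $\mathcal{S}_n^t=\{\mathbf{r}^{t-1}_{n,\infty},\mathbf{r}^{t+1}_{n,\infty}\}$ and let $\iota^\xi\in\mathbb{R}$ be a decision threshold for the log-likelihood ratio $$\xi^t_n=\log\left(\frac{p(\mathbf{r}^t_{n,\infty},\mathcal{S}^t_n\mid\lambda^t_n=1)}{p(\mathbf{r}^t_{n,\infty},\mathcal{S}^t_n\mid\lambda^t_n=0)}\right).$$ Then the decision rule that declares the device active ($H_1$) when $\xi_n^t>\iota^\xi$ and inactive ($H_0$) when $\xi_n^t<\iota^\xi$ is equivalent to the rule that declares it active when $\|\mathbf{r}^t_{n,\infty}\|_2^2>\iota^r_n$ and inactive when $\|\mathbf{r}^t_{n,\infty}\|_2^2<\iota^r_n$ (that is, $\xi^t_n>\iota^\xi\iff\|\mathbf{r}^t_{n,\infty}\|_2^2>\iota^r_n$ and $\xi^t_n<\iota^\xi\iff\|\mathbf{r}^t_{n,\infty}\|_2^2<\iota^r_n$), where the decision threshold is $$\iota^r_n=\frac{\iota^\xi+M\log\left(\frac{e^t_\infty+\beta}{e^t_\infty}\right)+\log\left(\frac{p_a}{1-p_a}\cdot\frac{\phi^t_{n,\infty}(\mathbf{r}^t_{n,\infty},\mathcal{S}^t_n)}{\upsilon^t_{n,\infty}}\right)}{\Xi^t_\infty}.$$ Here $$\phi^t_{n,\infty}(\mathbf{r}^t_{n,\infty},\mathcal{S}^t_n)=\upsilon^t_{n,\infty}\cdot\frac{1-p_a}{p_a}\cdot\frac{p_{01}+(1-p_{01})\upsilon^{t-1}_{n,\infty}}{p_{11}+(1-p_{11})\upsilon^{t-1}_{n,\infty}}\cdot\frac{p_{01}+(1-p_{01})\upsilon^{t+1}_{n,\infty}}{p_{11}+(1-p_{11})\upsilon^{t+1}_{n,\infty}},$$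 and, for $\tau\in\{t-1,t,t+1\}$, $$\upsilon^\tau_{n,\infty}=\left(\frac{\beta+e^\tau_\infty}{e^\tau_\infty}\right)^{M}\exp\left(-\Xi^\tau_\infty\|\mathbf{r}^\tau_{n,\infty}\|_2^2\right),\qquad \Xi^\tau_\infty=(e^\tau_\infty)^{-1}-(e^\tau_\infty+\beta)^{-1}.$$
   Context: Fix an integer $M\ge 1$ (number of antennas) and a real $\beta>0$. All vectors are row vectors in $\mathbb{C}^{1\times M}$, and $p(\cdot\mid\cdot)$ denotes (joint) conditional density with respect to Lebesgue measure. $\mathcal{CN}(0,\sigma\mathbf{I})$ denotes the circularly symmetric complex Gaussian law with density $(\pi\sigma)^{-M}\exp(-\|\mathbf{x}\|_2^2/\sigma)$. Activity: $(\lambda_n^\tau)_\tau$ is a stationary first-order Markov chain with values in $\{0,1\}$, with $p_{01}=\Pr(\lambda_n^{\tau+1}=1\mid\lambda_n^\tau=0)$ and $p_{11}=\Pr(\lambda_n^{\tau+1}=1\mid\lambda_n^\tau=1)$. Its stationary active probability is $p_a=\Pr(\lambda_n^\tau=1)\in(0,1)$, so that $p_a=p_{01}/(1-p_{11}+p_{01})$ whenever the denominator is nonzero. Channels: $\mathbf{x}_n^\tau=\lambda_n^\tau\mathbf{h}_n^\tau$ with $\mathbf{h}_n^\tau\sim\mathcal{CN}(0,\beta\mathbf{I})$. Observations (converged matched-filter outputs of the AMP iteration, modeled by state evolution with covariance equal to a scaled identity): for $\tau\in\{t-1,t,t+1\}$, $\mathbf{r}^\tau_{n,\infty}=\mathbf{x}^\tau_n+\sqrt{e^\tau_\infty}\,\mathbf{d}^\tau_n$,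 where $\mathbf{d}^\tau_n\sim\mathcal{CN}(0,\mathbf{I})$ and the $e^\tau_\infty>0$ are deterministic constants. The vectors $\mathbf{h}^{\tau}_n,\mathbf{d}^{\tau}_n$ for $\tau\in\{t-1,t,t+1\}$ are mutually independent and independent of the activity chain. The hypotheses are $H_0:\lambda_n^t=0$ and $H_1:\lambda_n^t=1$. *)

(* Defs.v *)
From HB Require Import structures.
From mathcomp Require Import all_boot all_order all_algebra.
From mathcomp Require Import all_classical all_reals all_analysis.
From mathcomp Require Import complex.

Set Implicit Arguments.
Unset Strict Implicit.
Unset Printing Implicit Defensive.

Import Order.TTheory GRing.Theory Num.Theory.
Import numFieldNormedType.Exports.

Local Open Scope classical_set_scope.
Local Open Scope ring_scope.

HB.instance Definition _ (R : realType) := PseudoPointedMetric.copy R[i] R[i]^o.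

(* [m1 \x m2] itself only inherits a sigma-finite structure from
   subprobabilities; this copy carries the one coming from sigma-finite m1, m2. *)
Section product_sigma_finite.
Context d1 d2 (T1 : measurableType d1) (T2 : measurableType d2) (R : realType).
Variable m1 : {sigma_finite_measure set T1 -> \bar R}.
Variable m2 : {sigma_finite_measure set T2 -> \bar R}.

Definition prod_measure : set (T1 * T2) -> \bar R := (m1 \x m2)%E.

HB.instance Definition _ := Measure.on prod_measure.

Let prod_measure_sigma_finite : sigma_finite setT prod_measure.
Proof.
have /sigma_finiteP[F [TF ndF Foo]] := sigma_finiteT m1.
have /sigma_finiteP[G [TG ndG Goo]] := sigma_finiteT m2.
exists (fun n => F n `*` G n).
  rewrite -setXTT TF TG predeqE => -[x y]; split.
    move=> [/= [n _ Fnx] [k _ Gky]]; exists (maxn n k) => //; split.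
    - by move: x Fnx; exact/subsetPset/ndF/leq_maxl.
    - by move: y Gky; exact/subsetPset/ndG/leq_maxr.
  by move=> [n _ []/= ? ?]; split; exists n.
move=> k; have [? ?] := Foo k; have [? ?] := Goo k.
split; first exact: measurableX.
by rewrite /prod_measure product_measure1E// lte_mul_pinfty// ge0_fin_numE.
Qed.

HB.instance Definition _ := Measure_isSigmaFinite.Build _ _ _ prod_measure
  prod_measure_sigma_finite.
End product_sigma_finite.

(* Image of a sigma-finite measure under a measurable map f; the measurable
   left inverse g only serves to make the image sigma-finite. *)
Section image_sigma_finite.
Context d1 d2 (T1 : measurableType d1) (T2 : measurableType d2) (R : realType).
Variables (m : {sigma_finite_measure set T1 -> \bar R}).
Variables (f : T1 -> T2) (g : T2 -> T1).

Definition image_measure (_ : measurable_fun setT f) (_ : measurable_fun setT g)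
  (_ : cancel f g) : set T2 -> \bar R := pushforward m f.

Hypotheses (mf : measurable_fun setT f) (mg : measurable_fun setT g).
Hypothesis fK : cancel f g.

Let mpreim A : measurable A -> measurable (f @^-1` A).
Proof. by move=> mA; rewrite -[X in measurable X]setTI; exact: mf. Qed.

Let image0 : image_measure mf mg fK set0 = 0%E.
Proof. by rewrite /image_measure /pushforward preimage_set0 measure0. Qed.

Let image_ge0 A : (0 <= image_measure mf mg fK A)%E.
Proof. exact: measure_ge0. Qed.

Let image_sigma_additive : semi_sigma_additive (image_measure mf mg fK).
Proof.
move=> F mF tF mUF; rewrite /image_measure /pushforward preimage_bigcup.
apply: measure_semi_sigma_additive; first by move=> n; exact: mpreim.
- apply/trivIsetP => /= i j _ _ ij; rewrite -preimage_setI.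
  by move/trivIsetP : tF => /(_ _ _ _ _ ij) ->//; rewrite preimage_set0.
- by rewrite -preimage_bigcup; exact: mpreim.
Qed.

HB.instance Definition _ := isMeasure.Build _ _ _ (image_measure mf mg fK)
  image0 image_ge0 image_sigma_additive.

Let image_sigma_finite : sigma_finite setT (image_measure mf mg fK).
Proof.
have [F TF Foo] := sigma_finiteT m.
exists (fun k => g @^-1` F k).
  by rewrite -preimage_bigcup -TF preimage_setT.
move=> k; have [mF Fk] := Foo k; split.
  by rewrite -[X in measurable X]setTI; exact: mg.
rewrite /image_measure /pushforward -comp_preimage.
by rewrite (_ : g \o f = id) //; apply/funext => x /=; rewrite fK.
Qed.

HB.instance Definition _ := Measure_isSigmaFinite.Build _ _ _
  (image_measure mf mg fK) image_sigma_finite.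
End image_sigma_finite.

Section complex_measurable.
Variable R : realType.

Definition complex_pair (z : R[i]) : measurableTypeR R * measurableTypeR R :=
  (complex.Re z, complex.Im z).
Definition pair_complex (p : measurableTypeR R * measurableTypeR R) : R[i] :=
  Complex p.1 p.2.

Lemma complex_pairK : cancel complex_pair pair_complex.
Proof. by case. Qed.

Lemma pair_complexK : cancel pair_complex complex_pair.
Proof. by case. Qed.

Definition complex_measurable : set (set R[i]) :=
  g_sigma_algebra_preimage complex_pair.

Let complex_measurable0 : complex_measurable set0.
Proof. by exists set0 => //; rewrite setTI preimage_set0. Qed.

Let complex_measurableC A : complex_measurable A -> complex_measurable (~` A).
Proof.
move=> [B mB <-]; exists (~` B); first exact: measurableC.
by rewrite !setTI preimage_setC.
Qed.

Let complex_measurable_bigcup (F : (set R[i])^nat) :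
  (forall k, complex_measurable (F k)) -> complex_measurable (\bigcup_k F k).
Proof.
move=> mF; have Fp k : F k = complex_pair @^-1` (pair_complex @^-1` F k).
  by rewrite -comp_preimage; apply/seteqP; split=> z /=; rewrite complex_pairK.
exists (\bigcup_k pair_complex @^-1` F k).
  apply: bigcup_measurable => k _; have [B mB <-] := mF k.
  rewrite setTI -comp_preimage (_ : _ \o _ = id) //.
  by apply/funext => p /=; rewrite pair_complexK.
by rewrite setTI preimage_bigcup; apply: eq_bigcupr => k _.
Qed.

HB.instance Definition _ := @isMeasurable.Build default_measure_display R[i]
  complex_measurable complex_measurable0 complex_measurableC
  complex_measurable_bigcup.

Lemma measurable_complex_pair : measurable_fun setT complex_pair.
Proof. by move=> _ A mA; exists A. Qed.

Lemma measurable_pair_complex : measurable_fun setT pair_complex.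
Proof.
move=> _ A [B mB <-]; rewrite !setTI -comp_preimage (_ : _ \o _ = id) //.
by apply/funext => p /=; rewrite pair_complexK.
Qed.

(* Lebesgue measure on C identified with R^2 through (Re, Im). *)
Definition lebesgue_complex : {sigma_finite_measure set R[i] -> \bar R} :=
  image_measure (prod_measure (@lebesgue_measure R) (@lebesgue_measure R))
    measurable_pair_complex measurable_complex_pair pair_complexK.
End complex_measurable.

Section matrix_measurable.
Context d (T : measurableType d) (m n : nat).

Definition matrix_measurable : set (set 'M[T]_(m, n)) :=
  <<s \bigcup_(ij in [set: 'I_m * 'I_n])
        preimage_set_system setT (fun A : 'M[T]_(m, n) => A ij.1 ij.2)
          measurable >>.

HB.instance Definition _ := @isMeasurable.Build default_measure_display
  'M[T]_(m, n) matrix_measurable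
  (@sigma_algebra0 _ setT _) (@sigma_algebraC _ _) (@sigma_algebra_bigcup _ setT _).

Lemma measurable_entry i j :
  measurable_fun setT (fun A : 'M[T]_(m, n) => A i j).
Proof.
move=> _ B mB; apply: sub_sigma_algebra.
by exists (i, j) => //; exists B.
Qed.

Lemma measurable_matrix d' (U : measurableType d') (f : U -> 'M[T]_(m, n)) :
  (forall i j, measurable_fun setT (fun u => f u i j)) -> measurable_fun setT f.
Proof.
move=> mf; apply: (@measurability _ _ U 'M[T]_(m, n) setT f _ erefl).
move=> _ [_ [[i j] _ [B mB <-]] <-].
by have := mf i j measurableT B mB; rewrite !setTI.
Qed.
End matrix_measurable.

Section power_measure.
Context d (T : measurableType d) (R : realType).

Definition cons_row n (p : T * 'rV[T]_n) : 'rV[T]_n.+1 :=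
  \row_j (if unlift ord0 j is Some k then p.2 0 k else p.1).

Definition uncons_row n (v : 'rV[T]_n.+1) : T * 'rV[T]_n :=
  (v 0 0, \row_j v 0 (lift ord0 j)).

Lemma cons_row0 n (p : T * 'rV[T]_n) i : cons_row p i 0 = p.1.
Proof. by rewrite mxE unlift_none. Qed.

Lemma cons_rowS n (p : T * 'rV[T]_n) i j :
  cons_row p i (lift ord0 j) = p.2 0 j.
Proof. by rewrite mxE liftK. Qed.

Lemma cons_rowK n : cancel (@cons_row n) (@uncons_row n).
Proof.
move=> [x v]; rewrite /uncons_row cons_row0; congr (_, _).
by apply/rowP => j; rewrite mxE cons_rowS.
Qed.

Lemma measurable_cons_row n : measurable_fun setT (@cons_row n).
Proof.
apply: measurable_matrix => i j; have [k ->|->] := unliftP ord0 j.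
  under eq_fun do rewrite cons_rowS.
  exact: (measurableT_comp (measurable_entry 0 k) measurable_snd).
by under eq_fun do rewrite cons_row0; exact: measurable_fst.
Qed.

Lemma measurable_uncons_row n : measurable_fun setT (@uncons_row n).
Proof.
apply/measurable_fun_pairP; split; first exact: measurable_entry.
apply: measurable_matrix => i j.
by under eq_fun do rewrite /= mxE; exact: measurable_entry.
Qed.

Variable mu : {sigma_finite_measure set T -> \bar R}.

(* n-fold product of mu, indexed by the columns of a row vector. *)
Fixpoint power_measure n : {sigma_finite_measure set 'rV[T]_n -> \bar R} :=
  match n with
  | 0 => \d_(const_mx point : 'rV[T]_0)
  | n'.+1 => image_measure (prod_measure mu (power_measure n'))
      (@measurable_cons_row n') (@measurable_uncons_row n') (@cons_rowK n')
  end.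
End power_measure.

Section complex_gaussian.
Context (R : realType) (M : nat).
Implicit Types (x : 'rV[R[i]]_M) (sigma : R).

Definition lebesgue_cvec : {sigma_finite_measure set 'rV[R[i]]_M -> \bar R} :=
  power_measure (lebesgue_complex R) M.

Definition norm2 x : R := Num.sqrt (\sum_(j < M) ComplexField.Normc.normc (x 0 j) ^+ 2).

Definition cgauss_pdf sigma x : R :=
  (pi * sigma) ^- M * expR (- (norm2 x ^+ 2 / sigma)).

Definition has_cgauss_law d (T : measurableType d) (P : probability T R)
    (X : {RV P >-> 'rV[R[i]]_M}) sigma : Prop :=
  forall A, measurable A ->
    (P (X @^-1` A) = \int[lebesgue_cvec]_(x in A) (cgauss_pdf sigma x)%:E)%E.
End complex_gaussian.

Section probability_notions.
Context d (T : measurableType d) (R : realType) (P : probability T R).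

Definition cond_prob (A B : set T) : R := fine (P (A `&` B)) / fine (P B).

(* The family F of classes of events is meant to consist of sigma-algebras. *)
Definition mutually_independent (I : finType) (F : I -> set (set T)) : Prop :=
  forall (J : {set I}) (A : I -> set T), (forall i, i \in J -> F i (A i)) ->
    (P (\bigcap_(i in [set` J]) A i) = \prod_(i in J) P (A i))%E.

(* f is one version of the density: versions agree only mu-almost everywhere. *)
Definition has_density d' (U : measurableType d')
    (mu : set U -> \bar R) (nu : set U -> \bar R) (f : U -> R) : Prop :=
  [/\ measurable_fun setT f, (forall u, 0 <= f u) &
      forall A, measurable A -> (nu A = \int[mu]_(u in A) (f u)%:E)%E].

Definition cond_law (U : Type) (Z : T -> U) (B : set T) (A : set U) : \bar R :=
  (cond_prob (Z @^-1` A) B)%:E.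

Variable lam : nat -> {RV P >-> bool}.

Definition state (tau : nat) (b : bool) : set T := lam tau @^-1` [set b].

Definition trajectory (k n : nat) (s : nat -> bool) : set T :=
  \bigcap_(i in `I_n) state (k + i) (s i).

Definition markov_chain : Prop :=
  forall (n : nat) (s : nat -> bool), (0 < P (trajectory 0 n.+1 s))%E ->
    cond_prob (state n.+1 (s n.+1)) (trajectory 0 n.+1 s) =
    cond_prob (state n.+1 (s n.+1)) (state n (s n)).

Definition stationary : Prop :=
  forall (k n : nat) (s : nat -> bool), P (trajectory k n s) = P (trajectory 0 n s).

Definition chain_sigma : set (set T) :=
  <<s \bigcup_tau g_sigma_algebra_preimage (lam tau) >>.
End probability_notions.

Section observations.
Context d (T : measurableType d) (R : realType) (P : probability T R) (M : nat).
Variables (lam : nat -> {RV P >-> bool}) (h noise : nat -> {RV P >-> 'rV[R[i]]_M}).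
Variable e : nat -> R.

Definition channel (tau : nat) (w : T) : 'rV[R[i]]_M :=
  (lam tau w)%:R *: h tau w.

Definition mf_output (tau : nat) (w : T) : 'rV[R[i]]_M :=
  channel tau w + real_complex R (Num.sqrt (e tau)) *: noise tau w.

(* The triple (r^t, (r^(t-1), r^(t+1))). *)
Definition observation (t : nat) (w : T) :
    'rV[R[i]]_M * ('rV[R[i]]_M * 'rV[R[i]]_M) :=
  (mf_output t w, (mf_output t.-1 w, mf_output t.+1 w)).

(* The sources of randomness seen from frame t: the whole activity chain (None),
   and the channel (Some (false, k)) and the noise (Some (true, k)) of the
   frames t.-1 + k for k < 3. *)
Definition source_sigma (t : nat) (s : option (bool * 'I_3)) : set (set T) :=
  match s with
  | None => chain_sigma lam
  | Some (false, k) => g_sigma_algebra_preimage (h (t.-1 + k))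
  | Some (true, k) => g_sigma_algebra_preimage (noise (t.-1 + k))
  end.
End observations.

Section decision.
Context (R : realType) (M : nat).
Notation vec := 'rV[R[i]]_M.

Definition lebesgue_obs : {sigma_finite_measure set (vec * (vec * vec))%type -> \bar R} :=
  prod_measure (lebesgue_cvec R M)
    (prod_measure (lebesgue_cvec R M) (lebesgue_cvec R M)).

Definition llr (f1 f0 : vec * (vec * vec) -> R) z : R := ln (f1 z / f0 z).

Variables (beta pa p01 p11 : R) (e : nat -> R).

Definition Xi (tau : nat) : R := (e tau)^-1 - (e tau + beta)^-1.

Definition upsilon (tau : nat) (r : vec) : R :=
  ((beta + e tau) / e tau) ^+ M * expR (- (Xi tau * norm2 r ^+ 2)).

Definition neighbour_ratio (tau : nat) (r : vec) : R :=
  (p01 + (1 - p01) * upsilon tau r) / (p11 + (1 - p11) * upsilon tau r).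

Definition phi (t : nat) (z : vec * (vec * vec)) : R :=
  upsilon t z.1 * ((1 - pa) / pa)
    * neighbour_ratio t.-1 z.2.1 * neighbour_ratio t.+1 z.2.2.

Definition energy_threshold (iota_xi : R) (t : nat) (z : vec * (vec * vec)) : R :=
  (iota_xi + M%:R * ln ((e t + beta) / e t)
     + ln (pa / (1 - pa) * (phi t z / upsilon t z.1))) / Xi t.

(* Rule 1 compares stat1 with thr1, rule 2 compares stat2 with thr2; ties are
   left undecided by both. *)
Definition rules_agree (stat1 thr1 stat2 thr2 : R) : Prop :=
  (stat1 > thr1 <-> stat2 > thr2) /\ (stat1 < thr1 <-> stat2 < thr2).
End decision.

(* Main.v *)
From HB Require Import structures.
Require Import Defs.
From mathcomp Require Import all_boot all_order all_algebra.
From mathcomp Require Import all_classical all_reals all_analysis.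
From mathcomp Require Import complex.
From mathcomp Require Import measurable_realfun ring lra.

(** Given the activity pattern (a, b, c) of frames t-1, t, t+1, the outputs are
    independent Gaussian vectors of variances [e + beta] (active) or [e]
    (inactive). A two-state stationary chain is reversible, so given
    [lambda^t = b] its two neighbours are independent, each active with
    probability [p11] or [p01] according to [b]. So the observation has, given
    [b], the density
      g_(e_t + b beta)(r^t) * mix_b(r^(t-1)) * mix_b(r^(t+1)),
      mix_b = p_b1 g_(e + beta) + (1 - p_b1) g_e.
    Since [g_e = upsilon * g_(e + beta)], each quotient [mix_1 / mix_0] is the
    inverse of the neighbour ratio, and the log-likelihood ratio is affine in
    [|r^t|^2] with slope [Xi > 0]. *)

Set Implicit Arguments.
Unset Strict Implicit.

Import Order.TTheory GRing.Theory Num.Theory.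
Import numFieldNormedType.Exports.
Local Open Scope classical_set_scope.
Local Open Scope ring_scope.

(** * Affine changes of variables *)

(** Lebesgue measure on complex row vectors is assembled from images and products of measures, so
    the translations and scalings needed for Gaussian integrals are proved on the real line and
    carried through that construction. Conditional independence is never formulated as such: laws
    are computed as unnormalised masses of [E] intersected with preimages, where [E] collects the
    activity pattern and the frames already treated, and the probability of [lambda^t = b] is
    divided out only at the end. On an event fixing the three activities, each channel is a fixed
    multiple of [h], which removes the product of two random factors. Joint laws are identified on
    rectangles. Since a conditional density is determined only almost everywhere, the explicit
    densities serve as reference for all other versions. Transition probabilities 0 and 1 are
    allowed: paths of probability zero contribute nothing, and the mixtures stay positive because
    [upsilon] is. *)

Section scales.
Local Open Scope ereal_scope.
Context {R : realType}.

(* Change of variables with constant Jacobian [k], phrased with integrals so that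
   it passes to product measures by Tonelli. *)
Definition scales d (T : measurableType d) (k : R)
    (m : set T -> \bar R) (f : T -> T) : Prop :=
  [/\ (0 <= k)%R, measurable_fun setT f &
   forall F : T -> \bar R, measurable_fun setT F -> (forall x, 0 <= F x) ->
    k%:E * \int[m]_x F (f x) = \int[m]_x F x].

(** The image of Lebesgue measure under the map, multiplied by [a], gives []u, v]] the mass [v - u],
    so it is Lebesgue measure by uniqueness. *)
Lemma scales_lebesgue (a b : R) : (0 < a)%R ->
  scales a (@lebesgue_measure R) (fun x => a * x + b)%R.
Proof.
move=> a0; set f := fun x : measurableTypeR R => (a * x + b)%R : measurableTypeR R.
have mf : measurable_fun setT f.
  by apply: measurable_funD => //; exact: measurable_funM.
split => //; first exact: ltW.
move=> F mF F0.
have -> : \int[lebesgue_measure]_x F (f x) =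
    \int[pushforward (@lebesgue_measure R) f]_x F x.
  by rewrite ge0_integral_pushforward.
pose a' : {nonneg R} := NngNum (ltW a0).
rewrite -[a]/(a'%:num)%R -(@ge0_integral_mscale _ _ _
  (pushforward (@lebesgue_measure R) f : measure _ _) setT measurableT)//.
apply: eq_measure_integral => A mA _.
apply/esym/lebesgue_measure_unique => //= _ [[u v]] _ <-.
rewrite /mscale/= /pushforward.
have -> : f @^-1` `]u, v]%classic = [set` `](u - b) / a, (v - b) / a]%R].
  apply/seteqP; split => [x|x]; rewrite /f/= !in_itv/=
    ltr_pdivrMr// ler_pdivlMr//;
    by rewrite ltrBlDr lerBrDr mulrC.
rewrite !lebesgue_measure_itv/= !lte_fin ltr_pM2r ?invr_gt0// ltrD2r.
case: ifPn => _; last by rewrite mule0.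
by rewrite -EFinD -EFinM -mulrBl mulrCA mulfV ?gt_eqF// mulr1 opprB addrA subrK.
Qed.

Lemma scales_prod d1 d2 (T1 : measurableType d1) (T2 : measurableType d2)
    (m1 : {sigma_finite_measure set T1 -> \bar R})
    (m2 : {sigma_finite_measure set T2 -> \bar R})
    (k1 k2 : R) (f1 : T1 -> T1) (f2 : T2 -> T2) :
  scales k1 m1 f1 -> scales k2 m2 f2 ->
  scales (k1 * k2) (prod_measure m1 m2) (fun z => (f1 z.1, f2 z.2)).
Proof.
move=> [k10 mf1 s1] [k20 mf2 s2]; split; first exact: mulr_ge0.
  apply/measurable_fun_pairP; split.
    exact: measurableT_comp mf1 measurable_fst.
  exact: measurableT_comp mf2 measurable_snd.
move=> F mF F0.
have mF12 : measurable_fun setT (fun z : T1 * T2 => F (f1 z.1, f2 z.2)).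
  apply: measurableT_comp mF _; apply/measurable_fun_pairP; split.
    exact: measurableT_comp mf1 measurable_fst.
  exact: measurableT_comp mf2 measurable_snd.
rewrite /prod_measure !fubini_tonelli1// /fubini_F/= EFinM -muleA.
rewrite -(s1 (fun x => \int[m2]_y F (x, y))); last 2 first.
- exact: (@measurable_fun_fubini_tonelli_F _ _ _ _ _ m2 F mF F0).
- by move=> x; exact: integral_ge0.
congr (_ * _); rewrite -ge0_integralZl//; last 2 first.
- exact: (@measurable_fun_fubini_tonelli_F _ _ _ _ _ m2 _ mF12).
- by move=> x _; exact: integral_ge0.
apply: eq_integral => x _; apply: (s2 (fun y => F (f1 x, y))) => //.
exact: measurableT_comp mF (measurable_pair1 _).
Qed.

(** Conjugation by [f]: since [g] is a left inverse, [f \o s \o g] composed with [f] is [f \o s],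
    and the integral over the image measure pulls back to one over [m]. *)
Lemma scales_image d1 d2 (T1 : measurableType d1) (T2 : measurableType d2)
    (m : {sigma_finite_measure set T1 -> \bar R})
    (f : T1 -> T2) (g : T2 -> T1) (mf : measurable_fun setT f)
    (mg : measurable_fun setT g) (fK : cancel f g) (k : R) (s : T1 -> T1) :
  scales k m s -> scales k (image_measure m mf mg fK) (f \o s \o g).
Proof.
move=> [k0 ms sE]; split => //.
  by apply: measurableT_comp mg; exact: measurableT_comp.
move=> F mF F0; rewrite /image_measure !ge0_integral_pushforward//; last first.
  apply: measurableT_comp mF _.
  by apply: measurableT_comp mg; exact: measurableT_comp.
rewrite preimage_setT -(sE (F \o f) (measurableT_comp mF mf) (fun x => F0 _)).
by congr (_ * _); apply: eq_integral => x _ /=; rewrite fK.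
Qed.

(** The maps [s j] may differ from one coordinate to the next, because a translation moves each
    coordinate by its own amount; only the Jacobian [k] is shared. *)
Lemma scales_power d (T : measurableType d)
    (mu : {sigma_finite_measure set T -> \bar R}) (k : R) n
    (s : 'I_n -> T -> T) :
  (forall j, scales k mu (s j)) ->
  scales (k ^+ n) (power_measure mu n)
    (fun v => \row_j s j (v ord0 j))%R.
Proof.
elim: n s => [s _|n IH s sj].
  rewrite (_ : (fun v => _) = id); last by apply/funext => v; apply/rowP => -[].
  by split => // F mF F0; rewrite expr0 mul1e.
have := scales_image (@measurable_cons_row _ _ n)
  (@measurable_uncons_row _ _ n) (@cons_rowK _ _ n)
  (scales_prod
    (sj ord0) (IH (fun j => s (lift ord0 j)) (fun j => sj _))).
rewrite -exprS/=; congr scales; apply/funext => v /=; apply/rowP => j.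
by rewrite !mxE /=; have [k' ->|->] := unliftP ord0 j; rewrite ?mxE.
Qed.

Lemma integral_power1 d (T : measurableType d)
    (mu : {sigma_finite_measure set T -> \bar R}) n (g : T -> R) :
  measurable_fun setT g -> (forall x, 0 <= g x)%R ->
  \int[mu]_x (g x)%:E = 1 ->
  \int[power_measure mu n]_v (\prod_(j < n) g (v ord0 j))%:E = 1.
Proof.
move=> mg g0 g1; elim: n => [|n IH].
  rewrite (eq_integral (cst 1)) => [|v _]; last by rewrite big_ord0.
  by rewrite integral_cst//= diracT mule1.
have mp p : measurable_fun setT (fun v : 'rV[T]_p => (\prod_(j < p) g (v ord0 j))%:E).
  apply/measurable_EFinP; apply: measurable_prod => j _.
  exact: measurableT_comp mg (measurable_entry _ _).
rewrite [LHS]/= /image_measure ge0_integral_pushforward//; last 3 first.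
- exact: measurable_cons_row.
- exact: mp.
- by move=> v _; rewrite lee_fin prodr_ge0.
rewrite preimage_setT /prod_measure fubini_tonelli1//; last 2 first.
- apply: measurableT_comp (mp _) _; exact: measurable_cons_row.
- by move=> v; rewrite lee_fin prodr_ge0.
rewrite /fubini_F -[RHS]g1; apply: eq_integral => x _.
rewrite -[RHS]mule1 -IH -ge0_integralZl//; last 3 first.
- exact: mp.
- by move=> v _; rewrite lee_fin prodr_ge0.
- by rewrite lee_fin.
apply: eq_integral => v _ /=; rewrite big_ord_recl cons_row0 EFinM.
by congr (_ * (_)%:E); apply: eq_bigr => j _; rewrite cons_rowS.
Qed.

End scales.

(** * Complex Gaussian densities *)

Section complex_vectors.
Context {R : realType}.
Notation Re := complex.Re.
Notation Im := complex.Im.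
Implicit Types (z : R[i]).

Lemma measurable_Re : measurable_fun setT (@complex.Re R).
Proof. exact: measurableT_comp measurable_fst (@measurable_complex_pair R). Qed.

Lemma measurable_Im : measurable_fun setT (@complex.Im R).
Proof. exact: measurableT_comp measurable_snd (@measurable_complex_pair R). Qed.

Lemma measurable_complexP d (T : measurableType d) (f : T -> R[i]) :
  measurable_fun setT (fun x => Re (f x)) ->
  measurable_fun setT (fun x => Im (f x)) -> measurable_fun setT f.
Proof.
move=> mr mi.
have -> : f = @pair_complex R \o (fun x => (Re (f x), Im (f x))).
  by apply/funext => x /=; rewrite /pair_complex/=; case: (f x).
apply: measurableT_comp; first exact: measurable_pair_complex.
by apply/measurable_fun_pairP; split.
Qed.

Lemma normc_sq z : ComplexField.Normc.normc z ^+ 2 = Re z ^+ 2 + Im z ^+ 2.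
Proof. by case: z => a b; rewrite sqr_sqrtr// addr_ge0// sqr_ge0. Qed.

Lemma norm2_sq M (x : 'rV[R[i]]_M) :
  norm2 x ^+ 2 = \sum_(j < M) (Re (x 0 j) ^+ 2 + Im (x 0 j) ^+ 2).
Proof.
rewrite /norm2 sqr_sqrtr; last by apply: sumr_ge0 => j _; exact: sqr_ge0.
by apply: eq_bigr => j _; rewrite normc_sq.
Qed.

(** The density of a single complex coordinate; [cgauss_pdf] is its product over the coordinates, so
    identities between Gaussian densities reduce to one complex variable. *)
Definition cgauss1 (s : R) z : R :=
  (pi * s)^-1 * expR (- ((Re z ^+ 2 + Im z ^+ 2) / s)).

Lemma cgauss1_ge0 s z : 0 < s -> 0 <= cgauss1 s z.
Proof.
by move=> s0; rewrite mulr_ge0 ?expR_ge0// invr_ge0 mulr_ge0 ?pi_ge0 ?ltW.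
Qed.

Lemma measurable_cgauss1 s : measurable_fun setT (cgauss1 s).
Proof.
apply: measurable_funM => //; apply: measurableT_comp => //.
apply: measurableT_comp => //; apply: measurable_funM => //.
by apply: measurable_funD; apply: measurable_funX;
  [exact: measurable_Re|exact: measurable_Im].
Qed.

Lemma cgauss_pdf_prod M s (x : 'rV[R[i]]_M) :
  cgauss_pdf s x = \prod_(j < M) cgauss1 s (x 0 j).
Proof.
rewrite /cgauss_pdf /cgauss1 norm2_sq [RHS]big_split/= prodr_const card_ord exprVn.
by rewrite -expR_sum sumrN mulr_suml.
Qed.

Lemma cgauss_pdf_ge0 M s (x : 'rV[R[i]]_M) : 0 < s -> 0 <= cgauss_pdf s x.
Proof. by move=> s0; rewrite cgauss_pdf_prod prodr_ge0// => j _; exact: cgauss1_ge0. Qed.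

Lemma cgauss_pdf_gt0 M s (x : 'rV[R[i]]_M) : 0 < s -> 0 < cgauss_pdf s x.
Proof.
by move=> s0; rewrite mulr_gt0 ?expR_gt0// invr_gt0 exprn_gt0// mulr_gt0 ?pi_gt0.
Qed.

Lemma measurable_cgauss_pdf M s : measurable_fun setT (@cgauss_pdf R M s).
Proof.
rewrite (_ : cgauss_pdf s = fun x : 'rV_M => \prod_(j < M) cgauss1 s (x 0 j)).
  apply: measurable_prod => j _.
  exact: measurableT_comp (measurable_cgauss1 s) (measurable_entry _ _).
by apply/funext => x; exact: cgauss_pdf_prod.
Qed.

(** The real and imaginary parts are independent centred normals of variance [s / 2], whence the
    standard deviation [t]. *)
Lemma integral_cgauss1 s : 0 < s ->
  (\int[lebesgue_complex R]_z (cgauss1 s z)%:E = 1)%E.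
Proof.
move=> s0; set t := Num.sqrt (s / 2).
have t0 : 0 < t by rewrite sqrtr_gt0 divr_gt0.
have t2 : t ^+ 2 *+ 2 = s.
  by rewrite sqr_sqrtr ?divr_ge0 ?ltW// -mulr_natr divfK// pnatr_eq0.
have gE (x y : R) : cgauss1 s (Complex x y) = normal_pdf 0 t x * normal_pdf 0 t y.
  rewrite normal_pdfE ?gt_eqF// /normal_fun /normal_peak -mulrnAl t2 !subr0.
  rewrite mulrACA -expRD /cgauss1/= -invfM -expr2 sqr_sqrtr; last first.
    by rewrite mulr_ge0 ?pi_ge0 ?ltW.
  by rewrite (mulrC pi) -mulNr opprD mulrDl.
have mg : measurable_fun setT (fun z => (cgauss1 s z)%:E).
  exact/measurable_EFinP/measurable_cgauss1.
rewrite /lebesgue_complex/= /image_measure ge0_integral_pushforward//; last 2 first.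
- exact: measurable_pair_complex.
- by move=> z _; rewrite lee_fin cgauss1_ge0.
rewrite preimage_setT /prod_measure fubini_tonelli1//; last 2 first.
- exact: measurableT_comp mg (@measurable_pair_complex R).
- by move=> z; rewrite lee_fin cgauss1_ge0.
rewrite -[RHS](integral_normal_pdf 0 t); apply: eq_integral => x _.
rewrite /fubini_F/= -[RHS]mule1 -[X in (_ * X)%E](integral_normal_pdf 0 t).
rewrite -ge0_integralZl//.
- by apply: eq_integral => y _; rewrite gE.
- by apply/measurable_EFinP; exact: measurable_normal_pdf.
- by move=> y _; rewrite lee_fin normal_pdf_ge0.
- by rewrite lee_fin normal_pdf_ge0.
Qed.

Lemma integral_cgauss_pdf M s : 0 < s ->
  (\int[lebesgue_cvec R M]_x (cgauss_pdf s x)%:E = 1)%E.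
Proof.
move=> s0.
rewrite -[RHS](integral_power1 M (measurable_cgauss1 s) _ (integral_cgauss1 s0)).
  by apply: eq_integral => x _; rewrite cgauss_pdf_prod.
by move=> z; exact: cgauss1_ge0.
Qed.

(** A real factor [a] scales the real and the imaginary part alike, so each complex coordinate
    contributes [a ^+ 2] to the Jacobian. *)
Lemma scales_cvec M (a : R) (w : 'rV[R[i]]_M) : 0 < a ->
  scales ((a ^+ 2) ^+ M) (lebesgue_cvec R M) (fun v => real_complex R a *: v + w).
Proof.
move=> a0.
have sC (j : 'I_M) := scales_image (@measurable_pair_complex R)
  (@measurable_complex_pair R) (@pair_complexK R)
  (scales_prod (scales_lebesgue (Re (w 0 j)) a0) (scales_lebesgue (Im (w 0 j)) a0)).
have := scales_power (fun j => sC j); rewrite -expr2; congr scales.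
apply/funext => v; apply/rowP => j; rewrite !mxE/= /pair_complex/=.
by case: (v 0 j) => x y; case: (w 0 j) => u t /=; simpc.
Qed.

Lemma measurable_linear_comb M (a b : R) :
  measurable_fun setT (fun z : 'rV[R[i]]_M * 'rV[R[i]]_M =>
    real_complex R a *: z.1 + real_complex R b *: z.2).
Proof.
apply: measurable_matrix => i j.
have m1 : measurable_fun setT (fun z : 'rV[R[i]]_M * 'rV[R[i]]_M => z.1 i j).
  exact: measurableT_comp (measurable_entry _ _) measurable_fst.
have m2 : measurable_fun setT (fun z : 'rV[R[i]]_M * 'rV[R[i]]_M => z.2 i j).
  exact: measurableT_comp (measurable_entry _ _) measurable_snd.
have E (z : 'rV[R[i]]_M * 'rV[R[i]]_M) :
    (real_complex R a *: z.1 + real_complex R b *: z.2) i j =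
    Complex (a * Re (z.1 i j) + b * Re (z.2 i j))
            (a * Im (z.1 i j) + b * Im (z.2 i j)).
  rewrite !mxE; case: (z.1 i j) => p q; case: (z.2 i j) => u v /=.
  by simpc.
by apply: measurable_complexP; under eq_fun do rewrite E/=;
  apply: measurable_funD; apply: measurable_funM => //;
  (exact: measurableT_comp measurable_Re _ ||
   exact: measurableT_comp measurable_Im _).
Qed.

Lemma measurable_output M (b : bool) (e : R) :
  measurable_fun setT (fun z : 'rV[R[i]]_M * 'rV[R[i]]_M =>
    b%:R *: z.1 + real_complex R (Num.sqrt e) *: z.2).
Proof.
by have := @measurable_linear_comb M b%:R (Num.sqrt e); rewrite rmorph_nat.
Qed.

End complex_vectors.

(** * Law of a matched-filter output with known activity *)

Section gaussian_sum.
Context {R : realType}.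

Lemma integral_indicM d (T : measurableType d) (m : {measure set T -> \bar R})
    (A : set T) (f : T -> \bar R) :
  (\int[m]_(x in A) f x = \int[m]_x ((\1_A x)%:E * f x))%E.
Proof.
rewrite integral_mkcond; apply: eq_integral => x _.
by rewrite patchE indicE; case: ifP => _; rewrite ?mul1e ?mul0e.
Qed.

(* Completing the square in [y]. *)
Lemma cgauss1_conv (beta e : R) (r y : R[i]) : 0 < beta -> 0 < e ->
  let q := Num.sqrt e in
  cgauss1 beta (r - real_complex R q * y) * cgauss1 1 y =
  cgauss1 (e + beta) r *
  cgauss1 (beta / (e + beta)) (y - real_complex R (q / (e + beta)) * r).
Proof.
move=> b0 e0 q; have q2 : e = q ^+ 2 by rewrite sqr_sqrtr// ltW.
have eb0 : e + beta != 0 by rewrite gt_eqF// addr_gt0.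
have b0' : beta != 0 by rewrite gt_eqF.
have pi0 : (pi : R) != 0 by rewrite gt_eqF// pi_gt0.
rewrite /cgauss1 mulrACA [RHS]mulrACA -!expRD; congr (_ * expR _).
  by move: (pi : R) pi0 => p p0; field; rewrite eb0 p0 b0'.
case: r => a b; case: y => c d /=.
(* With [e] replaced by [q ^+ 2], the exponents are rational expressions in [q], and the square root
   no longer matters. *)
clearbody q; move: eb0; rewrite q2 => eb0.
by field; rewrite eb0 b0'.
Qed.

Lemma cgauss_pdf_conv M (beta e : R) (r y : 'rV[R[i]]_M) : 0 < beta -> 0 < e ->
  let q := Num.sqrt e in
  cgauss_pdf beta (r - real_complex R q *: y) * cgauss_pdf 1 y =
  cgauss_pdf (e + beta) r *
  cgauss_pdf (beta / (e + beta)) (y - real_complex R (q / (e + beta)) *: r).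
Proof.
move=> b0 e0 q; rewrite !cgauss_pdf_prod -!big_split/=.
by apply: eq_bigr => j _; rewrite !mxE; exact: cgauss1_conv.
Qed.

(** The factor [e] is the Jacobian of [y -> sqrt e * y] on the complex plane; it cancels against the
    normalisation of the density of variance [e]. *)
Lemma cgauss1_scale (e : R) (y : R[i]) : 0 < e ->
  e * cgauss1 e (real_complex R (Num.sqrt e) * y) = cgauss1 1 y.
Proof.
move=> e0; set q := Num.sqrt e; have q2 : e = q ^+ 2 by rewrite sqr_sqrtr// ltW.
have q0 : q != 0 by rewrite gt_eqF// sqrtr_gt0.
have pi0 : (pi : R) != 0 by rewrite gt_eqF// pi_gt0.
rewrite /cgauss1 mulrA; congr (_ * expR _).
  by move: (pi : R) pi0 => p p0; field; rewrite p0 gt_eqF.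
case: y => c d /=; clearbody q; rewrite q2.
by field.
Qed.

Lemma cgauss_pdf_scale M (e : R) (y : 'rV[R[i]]_M) : 0 < e ->
  e ^+ M * cgauss_pdf e (real_complex R (Num.sqrt e) *: y) = cgauss_pdf 1 y.
Proof.
move=> e0; rewrite !cgauss_pdf_prod -[in e ^+ M](card_ord M) -prodr_const -big_split/=.
by apply: eq_bigr => j _; rewrite mxE cgauss1_scale.
Qed.

Section sum_law.
Variables (M : nat) (beta e : R).
Hypotheses (b0 : 0 < beta) (e0 : 0 < e).
Local Notation V := 'rV[R[i]]_M.
Local Notation L := (lebesgue_cvec R M).
Local Notation q := (Num.sqrt e).
Local Open Scope ereal_scope.

Let mg (s : R) : measurable_fun setT (fun x : V => (cgauss_pdf s x)%:E).
Proof. by apply/measurable_EFinP; exact: measurable_cgauss_pdf. Qed.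

Let maff (a : R) (w : V) :
  measurable_fun setT (fun v : V => real_complex R a *: v + w)%R.
Proof.
rewrite (_ : (fun v => _) = (fun z : V * V =>
    real_complex R a *: z.1 + real_complex R 1 *: z.2)%R \o (pair^~ w)).
  apply: measurableT_comp; first exact: measurable_linear_comb.
  exact: measurable_pair2.
by apply/funext => v /=; rewrite scale1r.
Qed.

Let translate (w : V) (F : V -> \bar R) : measurable_fun setT F ->
  (forall x, 0 <= F x) -> \int[L]_x F (x + w)%R = \int[L]_x F x.
Proof.
move=> mF F0; have [_ _ /(_ F mF F0) <-] := @scales_cvec R M 1 w ltr01.
by rewrite !expr1n mul1e; apply: eq_integral => x _; rewrite scale1r.
Qed.

(** Addition of variances for independent Gaussian vectors, tested on nonnegative functions so that
    Tonelli and the changes of variables apply directly; [output_law] takes an indicator for [F]. *)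
Lemma integral_cgauss_sum (b : bool) (F : V -> \bar R) : measurable_fun setT F ->
  (forall x, 0 <= F x) ->
  \int[prod_measure L L]_z
    (F (b%:R *: z.1 + real_complex R q *: z.2)%R *
     (cgauss_pdf beta z.1 * cgauss_pdf 1 z.2)%:E) =
  \int[L]_x (F x * (cgauss_pdf (e + b%:R * beta) x)%:E).
Proof.
move=> mF F0; have mlin := @measurable_output R M b e.
have p0 s (x : V) : (0 < s)%R -> 0 <= (cgauss_pdf s x)%:E.
  by move=> s0; rewrite lee_fin cgauss_pdf_ge0.
have pp0 s s' (x y : V) : (0 < s)%R -> (0 < s')%R ->
    0 <= (cgauss_pdf s x * cgauss_pdf s' y)%:E.
  by move=> s0 s'0; rewrite lee_fin mulr_ge0// cgauss_pdf_ge0.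
have mgp s s' : measurable_fun setT (fun z : V * V =>
    (cgauss_pdf s z.1 * cgauss_pdf s' z.2)%:E).
  apply/measurable_EFinP; apply: measurable_funM.
    exact: measurableT_comp (@measurable_cgauss_pdf R M s) measurable_fst.
  exact: measurableT_comp (@measurable_cgauss_pdf R M s') measurable_snd.
rewrite /prod_measure fubini_tonelli2/fubini_G/=; last 2 first.
- by apply: emeasurable_funM => //; exact: measurableT_comp mF mlin.
- by move=> z; rewrite mule_ge0// pp0.
(* For [b = true], translate [x] by [sqrt e y], exchange the integrals and complete
   the square; for [b = false], the scaling of Lebesgue measure suffices. *)
case: b {mlin} => /=.
  rewrite mul1r.
  have eb0 : (0 < e + beta)%R by rewrite addr_gt0.
  have s0 : (0 < beta / (e + beta))%R by rewrite divr_gt0.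
  transitivity (\int[L]_y \int[L]_r (F r *
      (cgauss_pdf beta (r - real_complex R q *: y) * cgauss_pdf 1 y)%:E)).
    apply: eq_integral => y _.
    rewrite -[RHS](translate (real_complex R q *: y)%R).
    - by apply: eq_integral => r _; rewrite addrK scale1r.
    - apply: emeasurable_funM => //; apply/measurable_EFinP.
      apply: measurable_funM => //.
      apply: measurableT_comp; first exact: measurable_cgauss_pdf.
      by under eq_fun do rewrite -[X in (X - _)%R]scale1r; exact: maff.
    - by move=> r; rewrite mule_ge0// pp0.
  rewrite -(fubini_tonelli (fun z : V * V => F z.1 *
      (cgauss_pdf beta (z.1 - real_complex R q *: z.2) *
       cgauss_pdf 1 z.2)%:E))/=; last 2 first.
  - apply: emeasurable_funM; first exact: measurableT_comp mF measurable_fst.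
    apply/measurable_EFinP; apply: measurable_funM.
      apply: measurableT_comp; first exact: measurable_cgauss_pdf.
      have := @measurable_linear_comb R M 1 (- q).
      by under eq_fun do rewrite scale1r rmorphN scaleNr.
    exact: measurableT_comp (@measurable_cgauss_pdf R M 1) measurable_snd.
  - by move=> z; rewrite mule_ge0// pp0.
  apply: eq_integral => r _.
  under eq_integral do rewrite cgauss_pdf_conv// EFinM muleA.
  rewrite ge0_integralZl//; last 3 first.
  - apply/measurable_EFinP; apply: measurableT_comp; first exact: measurable_cgauss_pdf.
    by under eq_fun do rewrite -[X in (X - _)%R]scale1r; exact: maff.
  - by move=> y _; exact: p0.
  - by rewrite mule_ge0// p0.
  (* The remaining factor is a Gaussian in [y] centred at a multiple of [r]; a translation centres
     it at 0 and its integral is 1. *)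
  rewrite (translate (- (real_complex R (q / (e + beta)) *: r))%R (mg _)
    (fun x => p0 _ x s0)).
  by rewrite integral_cgauss_pdf// mule1.
rewrite mul0r addr0.
transitivity (\int[L]_y (F (real_complex R q *: y)%R * (cgauss_pdf 1 y)%:E)).
  apply: eq_integral => y _.
  under eq_integral do rewrite scale0r add0r mulrC EFinM muleA.
  rewrite ge0_integralZl//.
  - by rewrite integral_cgauss_pdf// mule1.
  - by move=> x _; exact: p0.
  - by rewrite mule_ge0// p0.
have q0 : (0 < q)%R by rewrite sqrtr_gt0.
have q2 : (q ^+ 2 = e)%R by rewrite sqr_sqrtr// ltW.
have [_ _ sE] := @scales_cvec R M q 0 q0.
rewrite -(sE (fun x => F x * (cgauss_pdf e x)%:E)); last 2 first.
- exact: emeasurable_funM.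
- by move=> x; rewrite mule_ge0// p0.
rewrite q2 -ge0_integralZl//.
- apply: eq_integral => y _; rewrite addr0 muleCA -EFinM.
  by rewrite cgauss_pdf_scale.
- have mf : measurable_fun setT (fun x => F x * (cgauss_pdf e x)%:E).
    exact: emeasurable_funM.
  exact: measurableT_comp mf (maff _ _).
- by move=> y _; rewrite mule_ge0// p0.
- by rewrite lee_fin exprn_ge0// ltW.
Qed.

End sum_law.
End gaussian_sum.

(** * Joint densities *)

Section joint_densities.
Context {R : realType}.
Local Open Scope ereal_scope.

Lemma measure_with_density d (T : measurableType d)
    (m : {measure set T -> \bar R}) (f : T -> \bar R) :
  measurable_fun setT f -> (forall x, 0 <= f x) ->
  exists mu : {measure set T -> \bar R}, forall A, mu A = \int[m]_(x in A) f x.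
Proof.
move=> mf f0; pose mu A := \int[m]_(x in A) f x.
have mu0 : mu set0 = 0 by exact: integral_set0.
have mu_ge0 A : 0 <= mu A by exact: integral_ge0.
have mu_sigma : semi_sigma_additive mu.
  move=> F mF tF mUF; rewrite /mu ge0_integral_bigcup//; last exact: measurable_funS mf.
  by apply: is_cvg_ereal_nneg_natsum => n _; exact: mu_ge0.
by exists (HB.pack mu (isMeasure.Build _ _ _ mu mu0 mu_ge0 mu_sigma) :
  {measure set T -> \bar R}).
Qed.

Lemma restricted_law d d' (T : measurableType d) (U : measurableType d')
    (P : {measure set T -> \bar R}) (E : set T) (X : T -> U) :
  measurable E -> measurable_fun setT X ->
  exists mu : {measure set U -> \bar R}, forall A, mu A = P (E `&` X @^-1` A).
Proof.
move=> mE mX.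
exists (measure_function_pushforward__canonical__measure_function_Measure
  (mrestr P mE) mX) => A.
by rewrite /= /pushforward /mrestr setIC.
Qed.

(** Measurable rectangles are stable under intersection, contain the whole space and generate the
    product sigma-algebra; finiteness of [m] makes the constant sequence [setT] an admissible
    exhaustion. *)
Lemma eq_measure_rect d1 d2 (T1 : measurableType d1) (T2 : measurableType d2)
    (m m' : {measure set (T1 * T2) -> \bar R}) : m setT < +oo ->
  (forall A B, measurable A -> measurable B -> m (A `*` B) = m' (A `*` B)) ->
  forall C, measurable C -> m C = m' C.
Proof.
move=> moo mm' C mC.
pose G : set (set (T1 * T2)) := [set A `*` B | A in measurable & B in measurable].
apply: (measure_unique G (fun _ => setT)) => //.
- by rewrite measurable_prod_measurableType.
- move=> _ _ [A mA [B mB <-]] [A' mA' [B' mB' <-]].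
  exists (A `&` A'); first exact: measurableI.
  by exists (B `&` B'); [exact: measurableI|rewrite setXI].
- by move=> _; exists setT => //; exists setT => //; rewrite setXTT.
- by rewrite bigcup_const.
- by move=> _ [A mA [B mB <-]]; exact: mm'.
Qed.

Lemma integral_prodM d1 d2 (T1 : measurableType d1) (T2 : measurableType d2)
    (m1 : {sigma_finite_measure set T1 -> \bar R})
    (m2 : {sigma_finite_measure set T2 -> \bar R})
    (f1 : T1 -> \bar R) (f2 : T2 -> \bar R) :
  measurable_fun setT f1 -> measurable_fun setT f2 ->
  (forall x, 0 <= f1 x) -> (forall x, 0 <= f2 x) ->
  \int[prod_measure m1 m2]_z (f1 z.1 * f2 z.2) =
  \int[m1]_x f1 x * \int[m2]_y f2 y.
Proof.
move=> mf1 mf2 f10 f20; rewrite /prod_measure fubini_tonelli1//; last 2 first.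
- apply: emeasurable_funM.
    exact: measurableT_comp mf1 measurable_fst.
  exact: measurableT_comp mf2 measurable_snd.
- by move=> z; rewrite mule_ge0.
rewrite -ge0_integralZr//; last exact: integral_ge0.
by apply: eq_integral => x _; rewrite /fubini_F/= ge0_integralZl.
Qed.

(** As functions of [C], both sides are measures, the left one finite, and they agree on rectangles.
    The event [E] and the constant [c] absorb everything known about other variables, which allows
    the lemma to be applied repeatedly. *)
Lemma joint_density d d1 d2 (T : measurableType d) (T1 : measurableType d1)
    (T2 : measurableType d2) (P : probability T R) (E : set T)
    (X : T -> T1) (Y : T -> T2)
    (m1 : {sigma_finite_measure set T1 -> \bar R})
    (m2 : {sigma_finite_measure set T2 -> \bar R})
    (f1 : T1 -> R) (f2 : T2 -> R) (c : \bar R) :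
  measurable E -> measurable_fun setT X -> measurable_fun setT Y ->
  measurable_fun setT f1 -> measurable_fun setT f2 ->
  (forall x, 0 <= f1 x)%R -> (forall x, 0 <= f2 x)%R -> 0 <= c ->
  (forall A B, measurable A -> measurable B ->
    P (E `&` X @^-1` A `&` Y @^-1` B) =
    c * (\int[m1]_(x in A) (f1 x)%:E * \int[m2]_(y in B) (f2 y)%:E)) ->
  forall C, measurable C ->
    P (E `&` (fun w => (X w, Y w)) @^-1` C) =
    c * \int[prod_measure m1 m2]_(z in C) (f1 z.1 * f2 z.2)%:E.
Proof.
move=> mE mX mY mf1 mf2 f10 f20 c0 rect C mC.
have mf : measurable_fun setT (fun z : T1 * T2 => (f1 z.1 * f2 z.2)%:E).
  apply/measurable_EFinP; apply: measurable_funM.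
    exact: measurableT_comp mf1 measurable_fst.
  exact: measurableT_comp mf2 measurable_snd.
have f0 z : 0 <= (f1 z.1 * f2 z.2)%:E by rewrite lee_fin mulr_ge0.
have mXY : measurable_fun setT (fun w => (X w, Y w)) by apply/measurable_fun_pairP.
have [mu muE] := restricted_law P mE mXY.
have [nu nuE] := measure_with_density (prod_measure m1 m2)
  (measurable_funeM c mf) (fun z => mule_ge0 c0 (f0 z)).
rewrite -muE -ge0_integralZl//; last exact: measurable_funS mf.
rewrite -nuE; apply: eq_measure_rect mC.
  rewrite muE (le_lt_trans (probability_le1 P _))// ?ltry//.
  by apply: measurableI => //; rewrite preimage_setT.
move=> A B mA mB; rewrite muE nuE integral_indicM.
have mind d' (U : measurableType d') (D : set U) (f : U -> R) : measurable D ->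
    measurable_fun setT f -> measurable_fun setT (fun x => (\1_D x)%:E * (f x)%:E).
  by move=> mD mf'; apply: emeasurable_funM; apply/measurable_EFinP.
have ind0 d' (U : measurableType d') (D : set U) (f : U -> R) :
    (forall x, 0 <= f x)%R -> forall x, 0 <= (\1_D x)%:E * (f x)%:E.
  by move=> f0' x; rewrite mule_ge0// lee_fin.
transitivity (\int[prod_measure m1 m2]_z
    (c * (((\1_A z.1)%:E * (f1 z.1)%:E) * ((\1_B z.2)%:E * (f2 z.2)%:E)))).
  rewrite ge0_integralZl//; last 2 first.
  - apply: emeasurable_funM.
      exact: measurableT_comp (mind _ _ _ _ mA mf1) measurable_fst.
    exact: measurableT_comp (mind _ _ _ _ mB mf2) measurable_snd.
  - by move=> z _; rewrite mule_ge0// ind0.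
  rewrite (integral_prodM m1 m2 (mind _ _ _ _ mA mf1) (mind _ _ _ _ mB mf2)
    (ind0 _ _ _ _ f10) (ind0 _ _ _ _ f20)).
  by rewrite -!integral_indicM -rect// -setIA.
apply: eq_integral => z _; rewrite !indicE in_setX [RHS]muleCA; congr (_ * _).
by rewrite -!EFinM; congr EFin; rewrite -mulnb natrM mulrACA.
Qed.

Section output_law.
Context d (T : measurableType d) (P : probability T R).
Variables (M : nat) (beta e : R).
Local Notation V := 'rV[R[i]]_M.
Local Notation L := (lebesgue_cvec R M).
Variables (b : bool) (E : set T) (X Y : T -> V) (c : \bar R).
Hypotheses (b0 : (0 < beta)%R) (e0 : (0 < e)%R).

Lemma output_law :
  measurable E -> measurable_fun setT X -> measurable_fun setT Y ->
  (forall A B, measurable A -> measurable B ->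
    P (E `&` X @^-1` A `&` Y @^-1` B) =
    c * (\int[L]_(x in A) (cgauss_pdf beta x)%:E *
         \int[L]_(y in B) (cgauss_pdf 1 y)%:E)) ->
  forall C, measurable C ->
    P (E `&` (fun w => b%:R *: X w + real_complex R (Num.sqrt e) *: Y w)%R @^-1` C) =
    c * \int[L]_(x in C) (cgauss_pdf (e + b%:R * beta) x)%:E.
Proof.
move=> mE mX mY rect C mC.
(* On the whole space the Gaussian masses are 1, so the rectangle formula identifies [c] with the
   probability of [E]. *)
have c0 : 0 <= c.
  have := rect setT setT measurableT measurableT.
  by rewrite !integral_cgauss_pdf// !mule1 => <-.
have mG : measurable ((fun z : V * V =>
    b%:R *: z.1 + real_complex R (Num.sqrt e) *: z.2)%R @^-1` C).
  by rewrite -[X in measurable X]setTI; exact: measurable_output.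
have := joint_density mE mX mY (@measurable_cgauss_pdf R M beta)
  (@measurable_cgauss_pdf R M 1) (fun x => cgauss_pdf_ge0 x b0)
  (fun x => cgauss_pdf_ge0 x ltr01) c0 rect mG.
rewrite -comp_preimage => ->; congr (_ * _).
rewrite [LHS]integral_indicM [RHS]integral_indicM -integral_cgauss_sum//.
by apply/measurable_EFinP; exact: measurable_indic.
Qed.

End output_law.
End joint_densities.

(** * Joint law of three outputs with fixed activities *)

Section three_frames.
Context {R : realType} d (T : measurableType d) (P : probability T R).
Variables (M : nat) (beta : R).
Local Notation V := 'rV[R[i]]_M.
Local Notation leb := (lebesgue_cvec R M).
Local Notation gmass s A := (\int[leb]_(x in A) (cgauss_pdf s x)%:E)%E.
Variables (L : set T) (X0 Y0 X1 Y1 X2 Y2 : T -> V).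
Variables (e0 e1 e2 : R) (b0 b1 b2 : bool).
Hypotheses (beta0 : 0 < beta) (e0_gt0 : 0 < e0) (e1_gt0 : 0 < e1) (e2_gt0 : 0 < e2).
Hypothesis mL : measurable L.
Hypotheses (mX0 : measurable_fun setT X0) (mY0 : measurable_fun setT Y0).
Hypotheses (mX1 : measurable_fun setT X1) (mY1 : measurable_fun setT Y1).
Hypotheses (mX2 : measurable_fun setT X2) (mY2 : measurable_fun setT Y2).
Hypothesis rect : forall A0 B0 A1 B1 A2 B2,
  measurable A0 -> measurable B0 -> measurable A1 -> measurable B1 ->
  measurable A2 -> measurable B2 ->
  (P (L `&` (X0 @^-1` A0 `&` Y0 @^-1` B0) `&` (X1 @^-1` A1 `&` Y1 @^-1` B1)
        `&` (X2 @^-1` A2 `&` Y2 @^-1` B2)) =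
   P L * (gmass beta A0 * gmass 1 B0) * (gmass beta A1 * gmass 1 B1)
       * (gmass beta A2 * gmass 1 B2))%E.

Let out (e : R) (b : bool) (X Y : T -> V) : T -> V :=
  fun w => b%:R *: X w + real_complex R (Num.sqrt e) *: Y w.
Let r0 := out e0 b0 X0 Y0.
Let r1 := out e1 b1 X1 Y1.
Let r2 := out e2 b2 X2 Y2.

Let mpre (X : T -> V) A : measurable_fun setT X -> measurable A ->
  measurable (X @^-1` A).
Proof. by move=> mX mA; rewrite -[X in measurable X]setTI; exact: mX. Qed.

Let mout e b X Y : measurable_fun setT X -> measurable_fun setT Y ->
  measurable_fun setT (out e b X Y).
Proof.
move=> mX mY; have mXY : measurable_fun setT (fun w => (X w, Y w)).
  exact/measurable_fun_pairP.
exact: measurableT_comp (@measurable_output R M b e) mXY.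
Qed.

(** Each replacement is an instance of [output_law] in which the other two frames belong to the
    event [E] and their masses to the constant [c]; the rest is reordering of intersections and
    products. *)
Lemma output_rectangles C0 C1 C2 :
  measurable C0 -> measurable C1 -> measurable C2 ->
  (P (L `&` r0 @^-1` C0 `&` r1 @^-1` C1 `&` r2 @^-1` C2) =
   P L * gmass (e0 + b0%:R * beta) C0 * gmass (e1 + b1%:R * beta) C1
     * gmass (e2 + b2%:R * beta) C2)%E.
Proof.
move=> mC0 mC1 mC2.
have mr0 : measurable (r0 @^-1` C0) by apply: mpre => //; exact: mout.
have mr1 : measurable (r1 @^-1` C1) by apply: mpre => //; exact: mout.
(* The pairs [(X_k, Y_k)] are replaced one at a time by the outputs [r_k]. *)
have step0 A1 B1 A2 B2 : measurable A1 -> measurable B1 ->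
    measurable A2 -> measurable B2 ->
    (P (L `&` r0 @^-1` C0 `&` (X1 @^-1` A1 `&` Y1 @^-1` B1)
          `&` (X2 @^-1` A2 `&` Y2 @^-1` B2)) =
     P L * gmass (e0 + b0%:R * beta) C0 * (gmass beta A1 * gmass 1 B1)
       * (gmass beta A2 * gmass 1 B2))%E.
  move=> mA1 mB1 mA2 mB2.
  have mE : measurable (L `&` (X1 @^-1` A1 `&` Y1 @^-1` B1)
      `&` (X2 @^-1` A2 `&` Y2 @^-1` B2)).
    by do !apply: measurableI => //; exact: mpre.
  have := @output_law _ _ _ P _ beta e0 b0 _ X0 Y0
    (P L * (gmass beta A1 * gmass 1 B1) * (gmass beta A2 * gmass 1 B2))%E
    beta0 e0_gt0 mE mX0 mY0.
  move=> /(_ _ C0 mC0) H.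
  transitivity (P L * (gmass beta A1 * gmass 1 B1) * (gmass beta A2 * gmass 1 B2) *
    gmass (e0 + b0%:R * beta) C0)%E; last first.
    by rewrite muleAC; congr (_ * _)%E; rewrite muleAC.
  rewrite -H => [|A B mA mB].
    by congr (P _); rewrite predeqE => w /=; tauto.
  transitivity (P L * (gmass beta A * gmass 1 B) * (gmass beta A1 * gmass 1 B1) *
    (gmass beta A2 * gmass 1 B2))%E; last first.
    by rewrite [RHS]muleAC; congr (_ * _)%E; rewrite muleAC.
  by rewrite -rect//; congr (P _); rewrite predeqE => w /=; tauto.
have step1 A2 B2 : measurable A2 -> measurable B2 ->
    (P (L `&` r0 @^-1` C0 `&` r1 @^-1` C1 `&` (X2 @^-1` A2 `&` Y2 @^-1` B2)) =
     P L * gmass (e0 + b0%:R * beta) C0 * gmass (e1 + b1%:R * beta) C1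
       * (gmass beta A2 * gmass 1 B2))%E.
  move=> mA2 mB2.
  have mE : measurable (L `&` r0 @^-1` C0 `&` (X2 @^-1` A2 `&` Y2 @^-1` B2)).
    by do !apply: measurableI => //; exact: mpre.
  have := @output_law _ _ _ P _ beta e1 b1 _ X1 Y1
    (P L * gmass (e0 + b0%:R * beta) C0 * (gmass beta A2 * gmass 1 B2))%E
    beta0 e1_gt0 mE mX1 mY1.
  move=> /(_ _ C1 mC1) H; rewrite muleAC -H => [|A B mA mB].
    by congr (P _); rewrite predeqE => w /=; tauto.
  rewrite muleAC -step0//.
  by congr (P _); rewrite predeqE => w /=; tauto.
have mE : measurable (L `&` r0 @^-1` C0 `&` r1 @^-1` C1).
  by do !apply: measurableI => //; exact: mpre.
have := @output_law _ _ _ P _ beta e2 b2 _ X2 Y2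
  (P L * gmass (e0 + b0%:R * beta) C0 * gmass (e1 + b1%:R * beta) C1)%E
  beta0 e2_gt0 mE mX2 mY2.
move=> /(_ _ C2 mC2); apply => A B mA mB.
by rewrite -step1// setIA.
Qed.

(** The nesting of pairs calls for [joint_density] twice: for [r0] against the pair, then for [r1]
    against [r2] on the event where [r0] lies in [C0]. Index 0 will be frame t, indices 1 and 2 its
    predecessor and successor, as in [observation]. *)
Lemma output_joint_law C : measurable C ->
  (P (L `&` (fun w => (r0 w, (r1 w, r2 w))) @^-1` C) =
   P L * \int[lebesgue_obs R M]_(z in C)
     (cgauss_pdf (e0 + b0%:R * beta) z.1 *
       (cgauss_pdf (e1 + b1%:R * beta) z.2.1 *
        cgauss_pdf (e2 + b2%:R * beta) z.2.2))%:E)%E.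
Proof.
have s_gt0 e (b : bool) : 0 < e -> 0 < e + b%:R * beta.
  by move=> e_gt0; rewrite ltr_wpDr// mulr_ge0// ltW.
move=> mC; apply: (@joint_density _ _ _ _ _ _ _ _ _ r0 (fun w => (r1 w, r2 w))
  (lebesgue_cvec R M) (prod_measure (lebesgue_cvec R M) (lebesgue_cvec R M))
  (cgauss_pdf (e0 + b0%:R * beta))
  (fun z => cgauss_pdf (e1 + b1%:R * beta) z.1 * cgauss_pdf (e2 + b2%:R * beta) z.2)
  ) => //.
- exact: mout.
- by apply/measurable_fun_pairP; split; exact: mout.
- exact: measurable_cgauss_pdf.
- apply: measurable_funM.
    exact: measurableT_comp (@measurable_cgauss_pdf R M _) measurable_fst.
  exact: measurableT_comp (@measurable_cgauss_pdf R M _) measurable_snd.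
- by move=> x; rewrite cgauss_pdf_ge0// s_gt0.
- by move=> x; rewrite mulr_ge0// cgauss_pdf_ge0// s_gt0.
move=> C0 D mC0 mD.
rewrite muleA; apply: (@joint_density _ _ _ _ _ _ _ _ _ r1 r2) => //.
- by apply: measurableI => //; apply: mpre => //; exact: mout.
- exact: mout.
- exact: mout.
- exact: measurable_cgauss_pdf.
- exact: measurable_cgauss_pdf.
- by move=> x; rewrite cgauss_pdf_ge0// s_gt0.
- by move=> x; rewrite cgauss_pdf_ge0// s_gt0.
- by rewrite mule_ge0// integral_ge0// => x _; rewrite lee_fin cgauss_pdf_ge0// s_gt0.
by move=> C1 C2 mC1 mC2; rewrite output_rectangles// muleA.
Qed.
End three_frames.

(** * The activity chain *)

Section activity_chain.
Context {R : realType} d (T : measurableType d) (P : probability T R).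
Variable lam : nat -> {RV P >-> bool}.
Variables (pa p01 p11 : R).
Hypothesis markov : markov_chain lam.
Hypothesis stat : stationary lam.
Hypothesis H01 : forall tau,
  cond_prob P (state lam tau.+1 true) (state lam tau false) = p01.
Hypothesis H11 : forall tau,
  cond_prob P (state lam tau.+1 true) (state lam tau true) = p11.
Hypothesis Hpa : forall tau, P (state lam tau true) = pa%:E.
Hypothesis pa01 : 0 < pa < 1.

Definition trans_prob (b c : bool) : R :=
  let p := if b then p11 else p01 in if c then p else 1 - p.

Definition stat_prob (b : bool) : R := if b then pa else 1 - pa.

Lemma measurable_state tau b : measurable (state lam tau b).
Proof. by rewrite /state -[X in measurable X]setTI; exact: measurable_funP. Qed.
Local Hint Resolve measurable_state : core.

Lemma prob_fin A : measurable A -> P A = (fine (P A))%:E.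
Proof. by move=> mA; rewrite fineK// fin_num_measure. Qed.

Lemma prob_split_state tau A : measurable A ->
  fine (P A) = fine (P (A `&` state lam tau true)) + fine (P (A `&` state lam tau false)).
Proof.
move=> mA; rewrite -fineD ?fin_num_measure//; [|exact: measurableI|exact: measurableI].
rewrite -measureU//; [|exact: measurableI|exact: measurableI|].
  congr (fine (P _)); rewrite -setIUr; apply/esym/setIidl => w _ /=.
  by rewrite /state/=; case: (lam tau w); [left|right].
rewrite predeqE => w; split => // -[[_ +] [_]]; rewrite /state /= => ->//.
Qed.

Lemma prob_state tau b : fine (P (state lam tau b)) = stat_prob b.
Proof.
case: b => /=; first by rewrite Hpa.
have := prob_split_state tau measurableT.
by rewrite !setTI probability_setT/= Hpa/= => ->; rewrite addrAC subrr add0r.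
Qed.

Lemma stat_prob_gt0 b : 0 < stat_prob b.
Proof. by case/andP: pa01 => pa0 pa1; case: b => //=; rewrite subr_gt0. Qed.

Lemma cond_prob_trans tau b c :
  cond_prob P (state lam tau.+1 c) (state lam tau b) = trans_prob b c.
Proof.
have Ht b' : cond_prob P (state lam tau.+1 true) (state lam tau b') = trans_prob b' true.
  by case: b'; rewrite ?H11 ?H01.
case: c => //; have := Ht b; rewrite /cond_prob /trans_prob => <-.
have := prob_split_state tau.+1 (measurable_state tau b).
rewrite !(setIC (state lam tau b)) => E.
have n0 : fine (P (state lam tau b)) != 0 by rewrite prob_state gt_eqF// stat_prob_gt0.
by rewrite -[1 in RHS](divff n0) -mulrBl [in X in (X - _)]E addrAC subrr add0r.
Qed.

(** These are conditional probabilities given events of positive mass. The bounds keep the path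
    weights nonnegative and the mixtures positive. *)
Lemma trans_prob_itv b : 0 <= trans_prob b true <= 1.
Proof.
rewrite -(cond_prob_trans 0) /cond_prob.
have s0 : 0 < fine (P (state lam 0 b)) by rewrite prob_state stat_prob_gt0.
rewrite divr_ge0 ?fine_ge0//= ler_pdivrMr// mul1r fine_le ?fin_num_measure//.
  exact: measurableI.
by rewrite le_measure// inE//; exact: measurableI.
Qed.

Lemma prob_pair tau b c :
  fine (P (state lam tau b `&` state lam tau.+1 c)) = stat_prob b * trans_prob b c.
Proof.
rewrite -(cond_prob_trans tau) -(prob_state tau) /cond_prob mulrC divfK 1?setIC//.
by rewrite prob_state gt_eqF// stat_prob_gt0.
Qed.

(** Splitting frame 1 according to frame 0 gives [pa = pa * p11 + (1 - pa) * p01]. With two states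
    this already says that the flow from 0 to 1 equals the flow from 1 to 0. *)
Lemma detailed_balance b c : stat_prob b * trans_prob b c = stat_prob c * trans_prob c b.
Proof.
have := prob_split_state 0 (measurable_state 1 true).
rewrite !(setIC (state lam 1 true)) !prob_pair prob_state.
by rewrite /stat_prob /trans_prob; case: b; case: c => /= ?; lra.
Qed.

Lemma trajectoryS k n s :
  trajectory lam k n.+1 s = trajectory lam k n s `&` state lam (k + n) (s n).
Proof.
rewrite predeqE => w; split => [H|[H1 H2] i /= ilt].
  by split => [i /= ilt|]; apply: H => //=; exact: ltnW.
by move: ilt; rewrite ltnS leq_eqVlt => /predU1P[->//|]; exact: H1.
Qed.

Lemma trajectory3 k s : trajectory lam k 3 s =
  state lam k (s 0%N) `&` state lam k.+1 (s 1%N) `&` state lam k.+2 (s 2%N).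
Proof.
rewrite !trajectoryS addn0 addn1 addn2 (_ : trajectory lam k 0 s = setT) ?setTI//.
by rewrite predeqE => w; split => // _ i.
Qed.

Lemma trajectory2 k s : trajectory lam k 2 s =
  state lam k (s 0%N) `&` state lam k.+1 (s 1%N).
Proof.
rewrite !trajectoryS addn0 addn1 (_ : trajectory lam k 0 s = setT) ?setTI//.
by rewrite predeqE => w; split => // _ i.
Qed.

(** Stationarity moves the triple to frame 0, where the trajectories of the Markov property begin.
    Detailed balance then rewrites the first transition as one leaving the middle state, so that the
    two neighbours appear symmetrically. *)
Lemma prob_triple tau a b c :
  P (state lam tau a `&` state lam tau.+1 b `&` state lam tau.+2 c) =
  (stat_prob b * (trans_prob b a * trans_prob b c))%:E.
Proof.
pose s n := nth true [:: a; b; c] n.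
have m2 : measurable (state lam 0 a `&` state lam 1 b) by exact: measurableI.
have := stat tau 3 s; rewrite !trajectory3/= => ->.
have p2 : fine (P (state lam 0 a `&` state lam 1 b)) = stat_prob b * trans_prob b a.
  by rewrite prob_pair detailed_balance.
have := @markov 1 s; rewrite trajectory2/= cond_prob_trans => H.
have [p0|] := ltP 0%E (P (state lam 0 a `&` state lam 1 b)).
  rewrite prob_fin; last exact: measurableI.
  move: (H p0); rewrite /cond_prob p2 => <-; congr EFin.
  rewrite mulrA mulrC divfK 1?setIC// -p2 gt_eqF// fine_gt0// p0/=.
  by rewrite (le_lt_trans (probability_le1 P _))// ltry.
(* On a null pair the Markov property gives nothing, but both sides vanish: the triple is contained
   in the pair, and the mass of the pair is a factor on the right. *)
rewrite measure_le0 => /eqP P0.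
rewrite mulrA -p2 P0/= mul0r.
apply/eqP; rewrite -measure_le0 -P0 le_measure// inE//; exact: measurableI.
Qed.

Lemma chain_sigma_triple tau a b c :
  chain_sigma lam (state lam tau a `&` state lam tau.+1 b `&` state lam tau.+2 c).
Proof.
have S n x : chain_sigma lam (state lam n x).
  by apply: sub_sigma_algebra; exists n => //; exists [set x] => //; rewrite setTI.
apply: (@measurableI _ (g_sigma_algebraType
  (\bigcup_tau0 g_sigma_algebra_preimage (lam tau0)))); last exact: S.
by apply: (@measurableI _ (g_sigma_algebraType
  (\bigcup_tau0 g_sigma_algebra_preimage (lam tau0)))); exact: S.
Qed.

End activity_chain.

(** * The conditional densities and the likelihood ratio *)

Section continuity.
Context {R : realType}.

Lemma continuous_Re : continuous (@complex.Re R).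
Proof.
move=> z; have nz := nbhs_filter z; apply/cvgrPdist_lt => eps eps0 {nz}.
(* Balls of [R[i]] have radii in [R[i]], so the real [eps] is embedded; the estimate is that
   [|Re z|] is at most [|z|]. *)
apply/nbhs_ballP; exists (real_complex R eps) => /=; first by rewrite ltcR.
move=> w; rewrite /ball/= normc_def/= ltcR.
apply: le_lt_trans; case: z => a b; case: w => c f /=.
by rewrite -sqrtr_sqr ler_wsqrtr// lerDl sqr_ge0.
Qed.

Lemma continuous_Im : continuous (@complex.Im R).
Proof.
move=> z; have nz := nbhs_filter z; apply/cvgrPdist_lt => eps eps0 {nz}.
apply/nbhs_ballP; exists (real_complex R eps) => /=; first by rewrite ltcR.
move=> w; rewrite /ball/= normc_def/= ltcR.
apply: le_lt_trans; case: z => a b; case: w => c f /=.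
by rewrite -sqrtr_sqr ler_wsqrtr// lerDr sqr_ge0.
Qed.

Lemma continuous_entry (T : topologicalType) m n i j :
  continuous (fun A : 'M[T]_(m, n) => A i j).
Proof.
move=> A B nB; exists (fun i' j' => if (i' == i) && (j' == j) then B else setT) => /=.
  move=> i' j'; case: ifP => [/andP[/eqP -> /eqP ->]//|_]; exact: filterT.
by move=> A' /(_ i j); rewrite !eqxx.
Qed.

Lemma continuous_cgauss_pdf M s : continuous (@cgauss_pdf R M s).
Proof.
rewrite (_ : cgauss_pdf s = fun x : 'rV[R[i]]_M => (pi * s) ^- M * expR (-
  ((\sum_(j < M) (complex.Re (x 0 j) * complex.Re (x 0 j) +
      complex.Im (x 0 j) * complex.Im (x 0 j))) / s))); last first.
  by apply/funext => x; rewrite /cgauss_pdf norm2_sq.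
move=> x; have nx := nbhs_filter x; apply: cvgM; first exact: cvg_cst.
apply: continuous_comp; last exact: continuous_expR.
apply: cvgN; apply: cvgM; last exact: cvg_cst.
elim: (index_enum _) => [|j s' IH].
  by under eq_fun do rewrite big_nil; rewrite big_nil; exact: cvg_cst.
under eq_fun do rewrite big_cons; rewrite big_cons; apply: cvgD IH.
have cRe : complex.Re (y 0 j) @[y --> x] --> complex.Re (x 0 j).
  by apply: continuous_comp; [exact: continuous_entry|exact: continuous_Re].
have cIm : complex.Im (y 0 j) @[y --> x] --> complex.Im (x 0 j).
  by apply: continuous_comp; [exact: continuous_entry|exact: continuous_Im].
by apply: cvgD; exact: cvgM.
Qed.

End continuity.

(** * Explicit densities and the energy detector *)

Section densities.

(** Finiteness of [nu] makes the density [f] integrable, and functions with equal integrals over all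
    measurable sets agree almost everywhere. *)
Lemma has_density_ae_unique d (T : measurableType d) (R : realType)
    (mu : {measure set T -> \bar R}) (nu : set T -> \bar R) (f g : T -> R) :
  (nu setT < +oo)%E -> has_density mu nu f -> has_density mu nu g ->
  {ae mu, forall x, f x = g x}.
Proof.
move=> nuoo [mf f0 fE] [mg g0 gE].
have := @integral_ae_eq _ _ _ mu setT measurableT (EFin \o g) (EFin \o f).
case=> //.
- apply/integrableP; split; first exact/measurable_EFinP.
  rewrite (_ : (fun x => _) = (fun x => (f x)%:E)) -?fE//.
  by apply/funext => x /=; rewrite ger0_norm.
- exact/measurable_EFinP.
- by move=> A _ mA; rewrite -fE// -gE.
- move=> N [mN N0 sub]; exists N; split => // x /= H; apply: sub => /= E.
  by apply: H; apply: EFin_inj; exact: E.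
Qed.

Context {R : realType} (M : nat) (beta pa p01 p11 : R) (e : nat -> R).
Local Notation V := 'rV[R[i]]_M.
Hypothesis beta0 : 0 < beta.

(** Here [b] is the state of the middle frame, whereas [tau] is the neighbouring frame. By
    reversibility the same mixture serves the preceding and the following frame. *)
Definition neighbour_pdf (tau : nat) (b : bool) (r : V) : R :=
  trans_prob p01 p11 b true * cgauss_pdf (e tau + beta) r +
  trans_prob p01 p11 b false * cgauss_pdf (e tau) r.

Definition obs_pdf (t : nat) (b : bool) (z : V * (V * V)) : R :=
  cgauss_pdf (e t + b%:R * beta) z.1 *
  (neighbour_pdf t.-1 b z.2.1 * neighbour_pdf t.+1 b z.2.2).

Lemma measurable_neighbour_pdf tau b : measurable_fun setT (neighbour_pdf tau b).
Proof.
by apply: measurable_funD; apply: measurable_funM => //; exact: measurable_cgauss_pdf.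
Qed.

Lemma continuous_neighbour_pdf tau b : continuous (neighbour_pdf tau b).
Proof.
move=> x; have nx := nbhs_filter x.
by apply: cvgD; apply: cvgM; try exact: cvg_cst; exact: continuous_cgauss_pdf.
Qed.

Lemma measurable_obs_pdf t b : measurable_fun setT (obs_pdf t b).
Proof.
apply: measurable_funM.
  exact: measurableT_comp (@measurable_cgauss_pdf R M _) measurable_fst.
apply: measurable_funM.
  apply: measurableT_comp (measurable_neighbour_pdf _ _) _.
  exact: measurableT_comp measurable_fst measurable_snd.
apply: measurableT_comp (measurable_neighbour_pdf _ _) _.
exact: measurableT_comp measurable_snd measurable_snd.
Qed.

Lemma continuous_obs_pdf t b : continuous (obs_pdf t b).
Proof.
have c1 : continuous (fun z : V * (V * V) => z.1) by move=> z; exact: cvg_fst.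
have c2 : continuous (fun z : V * (V * V) => z.2) by move=> z; exact: cvg_snd.
have c21 : continuous (fun z : V * (V * V) => z.2.1).
  by move=> z; apply: (continuous_comp (c2 z)); exact: cvg_fst.
have c22 : continuous (fun z : V * (V * V) => z.2.2).
  by move=> z; apply: (continuous_comp (c2 z)); exact: cvg_snd.
move=> z; have nz := nbhs_filter z; apply: cvgM.
  exact: (continuous_comp (c1 z) (@continuous_cgauss_pdf R M _ _)).
by apply: cvgM;
  [exact: (continuous_comp (c21 z) (@continuous_neighbour_pdf _ _ _))
  |exact: (continuous_comp (c22 z) (@continuous_neighbour_pdf _ _ _))].
Qed.

Hypothesis trans01 : forall b, 0 <= trans_prob p01 p11 b true <= 1.

Lemma upsilon_gt0 tau (r : V) : 0 < e tau -> 0 < upsilon beta e tau r.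
Proof.
move=> e0; rewrite mulr_gt0 ?expR_gt0// exprn_gt0// divr_gt0// addr_gt0//.
Qed.

(** Thus [upsilon] is the likelihood ratio of one frame, inactive against active: the normalisations
    give the power [M], the difference of the exponents gives [Xi]. *)
Lemma upsilonE tau (r : V) : 0 < e tau ->
  cgauss_pdf (e tau) r = upsilon beta e tau r * cgauss_pdf (e tau + beta) r.
Proof.
move=> e0; have eb0 : e tau + beta != 0 by rewrite gt_eqF// addr_gt0.
rewrite /cgauss_pdf /upsilon mulrACA -expRD; congr (_ * expR _).
  rewrite -!exprVn -exprMn; congr (_ ^+ _).
  have: (pi : R) != 0 by rewrite gt_eqF// pi_gt0.
  move: (pi : R) => p p0; field.
  by rewrite p0 eb0 gt_eqF.
rewrite /Xi; field.
by rewrite eb0 gt_eqF.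
Qed.

(** At [p = 0] the expression is [u]; otherwise the first term is already positive. Hence no
    denominator vanishes, even for deterministic transitions. *)
Lemma mixture_gt0 (p u : R) : 0 <= p <= 1 -> 0 < u -> 0 < p + (1 - p) * u.
Proof.
move=> /andP[p0 p1] u0; have [->|pn] := eqVneq p 0; first by rewrite add0r subr0 mul1r.
by rewrite ltr_pwDl ?lt0r ?pn// mulr_ge0 ?subr_ge0// ltW.
Qed.

Lemma neighbour_pdfE tau b (r : V) : 0 < e tau ->
  let p := trans_prob p01 p11 b true in
  neighbour_pdf tau b r =
  (p + (1 - p) * upsilon beta e tau r) * cgauss_pdf (e tau + beta) r.
Proof.
by move=> e0 p; rewrite /neighbour_pdf upsilonE// mulrA -mulrDl; case: b @p.
Qed.

Lemma neighbour_ratio_gt0 tau (r : V) : 0 < e tau ->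
  0 < neighbour_ratio beta p01 p11 e tau r.
Proof.
move=> e0; rewrite divr_gt0// mixture_gt0 ?upsilon_gt0//.
  exact: (trans01 false).
exact: (trans01 true).
Qed.

Lemma rules_agree_obs_pdf t iota z : 0 < pa < 1 ->
  0 < e t.-1 -> 0 < e t -> 0 < e t.+1 ->
  rules_agree (llr (obs_pdf t true) (obs_pdf t false) z) iota
    (norm2 z.1 ^+ 2) (energy_threshold beta pa p01 p11 e iota t z).
Proof.
move=> /andP[pa0 pa1] em e0 ep.
have nrm := neighbour_ratio_gt0 z.2.1 em.
have nrp := neighbour_ratio_gt0 z.2.2 ep.
have u0 := upsilon_gt0 z.1 e0.
have eb0 : 0 < e t + beta by rewrite addr_gt0.
have Xi0 : 0 < Xi beta e t.
  by rewrite /Xi subr_gt0 ltf_pV2 ?posrE// ltrDl.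
have ratioE : obs_pdf t true z / obs_pdf t false z =
    (upsilon beta e t z.1 * (neighbour_ratio beta p01 p11 e t.-1 z.2.1 *
       neighbour_ratio beta p01 p11 e t.+1 z.2.2))^-1.
  rewrite /obs_pdf !neighbour_pdfE// mul1r mul0r addr0 upsilonE// /neighbour_ratio.
  have mix_n0 b tau (r : V) : 0 < e tau ->
      trans_prob p01 p11 b true + (1 - trans_prob p01 p11 b true) * upsilon beta e tau r != 0.
    by move=> e_gt0; rewrite gt_eqF// mixture_gt0// upsilon_gt0.
  have := mix_n0 true _ z.2.1 em; have := mix_n0 false _ z.2.1 em.
  have := mix_n0 true _ z.2.2 ep; have := mix_n0 false _ z.2.2 ep.
  rewrite /trans_prob => n1 n2 n3 n4.
  have g_n0 tau (r : V) : 0 < e tau -> cgauss_pdf (e tau + beta) r != 0.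
    by move=> e_gt0; rewrite gt_eqF// cgauss_pdf_gt0// addr_gt0.
  have ga := g_n0 _ z.1 e0; have gb := g_n0 _ z.2.1 em; have gc := g_n0 _ z.2.2 ep.
  by field; rewrite n1 n2 n3 n4 ga gb gc gt_eqF.
(* The prior odds and the [upsilon] of frame t cancel, so the threshold depends on the two
   neighbouring outputs only. *)
have phiE : pa / (1 - pa) * (phi beta pa p01 p11 e t z / upsilon beta e t z.1) =
    neighbour_ratio beta p01 p11 e t.-1 z.2.1 * neighbour_ratio beta p01 p11 e t.+1 z.2.2.
  rewrite /phi; field.
  by rewrite !gt_eqF// subr_gt0.
have llrE : llr (obs_pdf t true) (obs_pdf t false) z =
    Xi beta e t * norm2 z.1 ^+ 2 - M%:R * ln ((e t + beta) / e t) -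
    ln (neighbour_ratio beta p01 p11 e t.-1 z.2.1 * neighbour_ratio beta p01 p11 e t.+1 z.2.2).
  have q0 : 0 < (beta + e t) / e t by rewrite divr_gt0// addr_gt0.
  have lnu : ln (upsilon beta e t z.1) =
      M%:R * ln ((e t + beta) / e t) - Xi beta e t * norm2 z.1 ^+ 2.
    rewrite /upsilon lnM ?posrE ?exprn_gt0 ?expR_gt0// expRK lnXn//.
    by rewrite (addrC beta) mulr_natl.
  have nr0 := mulr_gt0 nrm nrp.
  rewrite /llr ratioE lnV ?posrE; last exact: mulr_gt0.
  by rewrite lnM ?posrE// lnu; ring.
rewrite /rules_agree /energy_threshold llrE phiE; set N := norm2 z.1 ^+ 2.
rewrite ltr_pdivrMr// ltr_pdivlMr// (mulrC N).
by split; split; lra.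
Qed.

End densities.

(** * Law of the observation given the activity of the middle frame *)

Section observation_law.
Context {R : realType} d (T : measurableType d) (P : probability T R).
Variables (M : nat) (beta pa p01 p11 : R) (lam : nat -> {RV P >-> bool}).
Variables (h noise : nat -> {RV P >-> 'rV[R[i]]_M}) (e : nat -> R) (tau : nat).
Local Notation V := 'rV[R[i]]_M.
Local Notation t := tau.+1.

(** Mutual independence is used for the full family of seven sources: the chain, three channels and
    three noises. *)
Lemma source_rectangles (L : set T) (A0 B0 A1 B1 A2 B2 : set V) :
  mutually_independent P (source_sigma lam h noise t) -> chain_sigma lam L ->
  measurable A0 -> measurable B0 -> measurable A1 -> measurable B1 ->
  measurable A2 -> measurable B2 ->
  (P (L `&` (h tau @^-1` A0 `&` noise tau @^-1` B0)
        `&` (h tau.+1 @^-1` A1 `&` noise tau.+1 @^-1` B1)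
        `&` (h tau.+2 @^-1` A2 `&` noise tau.+2 @^-1` B2)) =
   P L * (P (h tau @^-1` A0) * P (noise tau @^-1` B0))
     * (P (h tau.+1 @^-1` A1) * P (noise tau.+1 @^-1` B1))
     * (P (h tau.+2 @^-1` A2) * P (noise tau.+2 @^-1` B2)))%E.
Proof.
move=> indep cL mA0 mB0 mA1 mB1 mA2 mB2.
(* The defaults [A0] and [B0] only make [A k] and [B k] measurable for every [k]; the sources use
   [k < 3]. *)
pose A k := nth A0 [:: A0; A1; A2] k; pose B k := nth B0 [:: B0; B1; B2] k.
have mA k : measurable (A k) by case: k => [|[|[|k]]] //; rewrite /A nth_default.
have mB k : measurable (B k) by case: k => [|[|[|k]]] //; rewrite /B nth_default.
pose E (s : option (bool * 'I_3)) := match s with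
  | None => L
  | Some (false, k) => h (tau + k)%N @^-1` A k
  | Some (true, k) => noise (tau + k)%N @^-1` B k
  end.
have HE i : i \in [set: option (bool * 'I_3)]%SET -> source_sigma lam h noise t i (E i).
  case: i => [[[] k]|] _ //=.
    by exists (B k) => //; rewrite setTI.
  by exists (A k) => //; rewrite setTI.
have := indep _ E HE.
pose i0 : 'I_3 := @Ordinal 3 0 isT; pose i1 : 'I_3 := @Ordinal 3 1 isT.
pose i2 : 'I_3 := @Ordinal 3 2 isT.
(* An explicit enumeration of the seven sources, in the order of the claimed product. *)
pose s : seq (option (bool * 'I_3)) := [:: None; Some (false, i0); Some (true, i0);
  Some (false, i1); Some (true, i1); Some (false, i2); Some (true, i2)].
have ins i : i \in s.
  by case: i => [[[] [[|[|[|]]] //= lt]]|]; rewrite !inE.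
have us : uniq s by [].
have -> : \bigcap_(i in [set` [set: option (bool * 'I_3)]%SET]) E i =
    \bigcap_(i in [set` s]) E i.
  by rewrite predeqE => w; split => H i _; apply: H; [rewrite /= inE|exact: ins].
have -> : (\prod_(i in [set: option (bool * 'I_3)]%SET) P (E i) =
    \prod_(i <- s) P (E i))%E.
  rewrite -big_enum/=; apply: perm_big; apply: uniq_perm => //; first exact: enum_uniq.
  by move=> i; rewrite mem_enum inE ins.
rewrite bigcap_seq /s !big_cons !big_nil /= !addn0 !addn1 !addn2 mule1 setIT.
by rewrite /A /B /= -!setIA -!muleA.
Qed.

Hypothesis beta0 : 0 < beta.
Hypothesis markov : markov_chain lam.
Hypothesis stat : stationary lam.
Hypothesis H01 : forall n,
  cond_prob P (state lam n.+1 true) (state lam n false) = p01.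
Hypothesis H11 : forall n,
  cond_prob P (state lam n.+1 true) (state lam n true) = p11.
Hypothesis Hpa : forall n, P (state lam n true) = pa%:E.
Hypothesis pa01 : 0 < pa < 1.
Hypotheses (e0 : 0 < e tau) (e1 : 0 < e tau.+1) (e2 : 0 < e tau.+2).
Hypothesis gh : forall n, (tau <= n <= tau.+2)%N -> has_cgauss_law (h n) beta.
Hypothesis gn : forall n, (tau <= n <= tau.+2)%N -> has_cgauss_law (noise n) 1.
Hypothesis indep : mutually_independent P (source_sigma lam h noise t).
Local Notation obs := (observation lam h noise e t).

Let states a b c := state lam tau a `&` state lam tau.+1 b `&` state lam tau.+2 c.

(** The states [a b c] are in order of time, whereas [z] follows [observation] and has the middle
    frame first. *)
Definition path_pdf (a b c : bool) (z : V * (V * V)) : R :=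
  cgauss_pdf (e tau.+1 + b%:R * beta) z.1 *
  (cgauss_pdf (e tau + a%:R * beta) z.2.1 * cgauss_pdf (e tau.+2 + c%:R * beta) z.2.2).

Let eq_setIl (S : set T) (f g : T -> V * (V * V)) C :
  (forall w, S w -> f w = g w) -> S `&` f @^-1` C = S `&` g @^-1` C.
Proof.
by move=> fg; rewrite predeqE => w; split => -[Sw Cw]; split => //; move: Cw; rewrite /= fg.
Qed.

(** On [states a b c] the three activities are constants, so the observation coincides there with
    the outputs of [output_joint_law], and [prob_triple] gives the mass of the event. *)
Lemma path_law a b c C : measurable C ->
  (P (states a b c `&` obs @^-1` C) =
   (stat_prob pa b * (trans_prob p01 p11 b a * trans_prob p01 p11 b c))%:E *
   \int[lebesgue_obs R M]_(z in C) (path_pdf a b c z)%:E)%E.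
Proof.
move=> mC.
have mS : measurable (states a b c).
  by do !apply: measurableI; exact: measurable_state.
rewrite -(prob_triple markov stat H01 H11 Hpa pa01 tau a b c) -/(states a b c).
rewrite -(@output_joint_law _ _ _ P M beta (states a b c)
  (h tau.+1) (noise tau.+1) (h tau) (noise tau) (h tau.+2) (noise tau.+2))//.
- congr (P _); apply: eq_setIl => w; rewrite /states /state /= => -[[ha hb] hc].
  by rewrite /observation /mf_output /channel /= ha hb hc.
- move=> A1 B1 A0 B0 A2 B2 mA1 mB1 mA0 mB0 mA2 mB2.
  have k0 : (tau <= tau <= tau.+2)%N by rewrite leqnn -addn2 leq_addr.
  have k1 : (tau <= tau.+1 <= tau.+2)%N by rewrite !leqnSn.
  have k2 : (tau <= tau.+2 <= tau.+2)%N by rewrite leqnn -addn2 leq_addr.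
  rewrite -(gh k0 mA0) -(gn k0 mB0) -(gh k1 mA1) -(gn k1 mB1) -(gh k2 mA2) -(gn k2 mB2).
  rewrite (muleAC (P (states _ _ _))) -source_rectangles//; last exact: chain_sigma_triple.
  by congr (P _); rewrite predeqE => w /=; tauto.
Qed.

Lemma obs_pdf_paths b z : obs_pdf beta p01 p11 e tau.+1 b z =
  \sum_(a : bool) \sum_(c : bool)
    trans_prob p01 p11 b a * trans_prob p01 p11 b c * path_pdf a b c z.
Proof.
rewrite !big_bool /= /obs_pdf /path_pdf /neighbour_pdf /= !mul1r !mul0r !addr0.
by ring.
Qed.

Let mobs : measurable_fun setT obs.
Proof.
have mV n : measurable_fun setT (mf_output lam h noise e n).
  rewrite (_ : mf_output lam h noise e n =
    (fun z : V * V => real_complex R 1 *: z.1 + real_complex R (Num.sqrt (e n)) *: z.2)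
    \o (fun w => (channel lam h n w, noise n w))); last first.
    by apply/funext => w; rewrite /= rmorph1 scale1r.
  apply: measurableT_comp; first exact: measurable_linear_comb.
  apply/measurable_fun_pairP; split => //=.
  rewrite (_ : channel lam h n = fun w => if lam n w then h n w else 0); last first.
    by apply/funext => w; rewrite /channel; case: (lam n w); rewrite ?scale1r ?scale0r.
  apply: measurable_fun_ifT => //; exact: measurable_funP.
apply/measurable_fun_pairP; split; first exact: mV.
by apply/measurable_fun_pairP; split; exact: mV.
Qed.

(** Total probability over the states of both neighbours: the path laws sum to the expanded product
    of the two mixtures, with the common factor [stat_prob pa b], which the conditioning divides
    out. *)
Lemma obs_has_density b : has_density (lebesgue_obs R M)
  (cond_law P obs (state lam tau.+1 b)) (obs_pdf beta p01 p11 e tau.+1 b).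
Proof.
have tr0 b' c : 0 <= trans_prob p01 p11 b' c.
  by have /andP[? ?] := trans_prob_itv H01 H11 Hpa pa01 b'; case: c; rewrite // subr_ge0.
have s_gt0 n (x : bool) : 0 < e n -> 0 < e n + x%:R * beta.
  by move=> en; rewrite ltr_wpDr// mulr_ge0// ltW.
have path0 a c z : 0 <= path_pdf a b c z.
  have g0 n (x : bool) (r : V) : 0 < e n -> 0 <= cgauss_pdf (e n + x%:R * beta) r.
    by move=> en; rewrite cgauss_pdf_ge0// s_gt0.
  by rewrite mulr_ge0 ?g0// mulr_ge0 ?g0.
have mpath a c : measurable_fun setT (path_pdf a b c).
  have mg s := @measurable_cgauss_pdf R M s.
  apply: measurable_funM; first exact: measurableT_comp (mg _) measurable_fst.
  apply: measurable_funM; apply: measurableT_comp (mg _) _.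
    exact: measurableT_comp measurable_fst measurable_snd.
  exact: measurableT_comp measurable_snd measurable_snd.
split; first exact: measurable_obs_pdf.
  move=> z; rewrite obs_pdf_paths; apply: sumr_ge0 => a _; apply: sumr_ge0 => c _.
  by rewrite mulr_ge0// mulr_ge0.
move=> C mC; have mpre : measurable (obs @^-1` C).
  by rewrite -[X in measurable X]setTI; exact: mobs.
have mS n x : measurable (state lam n x) := measurable_state lam n x.
have split A n : measurable A ->
    P A = (\sum_(x : bool) P (A `&` state lam n x))%E.
  move=> mA; rewrite big_bool/= (prob_fin P mA) (prob_split_state lam n mA) EFinD.
  by rewrite -!prob_fin//; exact: measurableI.
have sb0 := stat_prob_gt0 pa01 b.
have E : (P (obs @^-1` C `&` state lam tau.+1 b) = (stat_prob pa b)%:E *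
    \int[lebesgue_obs R M]_(z in C) (obs_pdf beta p01 p11 e tau.+1 b z)%:E)%E.
  transitivity (\sum_(a : bool) \sum_(c : bool)
      P (states a b c `&` obs @^-1` C))%E.
    rewrite (split _ tau); last exact: measurableI.
    apply: eq_bigr => a _; rewrite (split _ tau.+2); last by do !apply: measurableI.
    by apply: eq_bigr => c _; congr (P _); rewrite /states predeqE => w /=; tauto.
  under eq_bigr do under eq_bigr do rewrite path_law//.
  under eq_integral do rewrite obs_pdf_paths -sumEFin.
  rewrite ge0_integral_sum//; last 2 first.
  - move=> a; apply/measurable_EFinP; apply: measurable_sum => c.
    by apply: measurable_funM => //; exact: measurable_funS (mpath _ _).
  - move=> a z _; rewrite lee_fin sumr_ge0// => c _.
    by rewrite mulr_ge0// mulr_ge0.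
  rewrite ge0_sume_distrr; last first.
    move=> a _; apply: integral_ge0 => z _; rewrite lee_fin sumr_ge0// => c _.
    by rewrite mulr_ge0// mulr_ge0.
  apply: eq_bigr => a _; under eq_integral do rewrite -sumEFin.
  rewrite ge0_integral_sum//; last 2 first.
  - move=> c; apply/measurable_EFinP.
    by apply: measurable_funM => //; exact: measurable_funS (mpath _ _).
  - by move=> c z _; rewrite lee_fin mulr_ge0// mulr_ge0.
  rewrite ge0_sume_distrr; last first.
    by move=> c _; apply: integral_ge0 => z _; rewrite lee_fin mulr_ge0// mulr_ge0.
  apply: eq_bigr => c _; under [in RHS]eq_integral do rewrite EFinM.
  rewrite ge0_integralZl//.
  - by rewrite muleA -EFinM.
  - by apply/measurable_EFinP; exact: measurable_funS (mpath _ _).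
  - by move=> z _; rewrite lee_fin.
  - by rewrite lee_fin mulr_ge0.
rewrite /cond_law /cond_prob (prob_state Hpa).
rewrite EFinM muleC -prob_fin; last exact: measurableI.
by rewrite E muleA -EFinM mulVf ?mul1e// gt_eqF.
Qed.

End observation_law.

(** A likelihood ratio depends on the chosen versions of the two densities. The equivalence is
    therefore asserted at every point for some continuous versions, and almost everywhere for
    arbitrary ones. The condition [0 < t] makes [t.-1] a genuine preceding frame. *)
Theorem theorem2 (R : realType) (dT : measure_display) (T : measurableType dT)
    (P : probability T R) (M : nat) (beta pa p01 p11 : R)
    (lam : nat -> {RV P >-> bool})
    (h noise : nat -> {RV P >-> 'rV[R[i]]_M})
    (e : nat -> R) (t : nat) (iota_xi : R) :
  (0 < M)%N -> 0 < beta ->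
  markov_chain lam -> stationary lam ->
  (forall tau, cond_prob P (state lam tau.+1 true) (state lam tau false) = p01) ->
  (forall tau, cond_prob P (state lam tau.+1 true) (state lam tau true) = p11) ->
  (forall tau, P (state lam tau true) = pa%:E) ->
  0 < pa < 1 ->
  (0 < t)%N ->
  (forall k : 'I_3, [/\ 0 < e (t.-1 + k)%N,
                        has_cgauss_law (h (t.-1 + k)%N) beta &
                        has_cgauss_law (noise (t.-1 + k)%N) 1]) ->
  mutually_independent P (source_sigma lam h noise t) ->
  let law b := cond_law P (observation lam h noise e t) (state lam t b) in
  let density := has_density (lebesgue_obs R M) in
  let agree f1 f0 z :=
    rules_agree (llr f1 f0 z) iota_xi
      (norm2 z.1 ^+ 2) (energy_threshold beta pa p01 p11 e iota_xi t z) in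
  (exists f1 f0, [/\ density (law true) f1, density (law false) f0,
                     continuous f1, continuous f0 & forall z, agree f1 f0 z]) /\
  (forall f1 f0, density (law true) f1 -> density (law false) f0 ->
     {ae lebesgue_obs R M, forall z, agree f1 f0 z}).
Proof.
move=> _ beta0 markov stat H01 H11 Hpa pa01 t0 src indep law density agree.
case: t t0 src indep @law @agree => [//|tau] _ src indep law agree.
have src_n n : (tau <= n <= tau.+2)%N ->
    [/\ 0 < e n, has_cgauss_law (h n) beta & has_cgauss_law (noise n) 1].
  move=> /andP[tn nt]; have lt : (n - tau < 3)%N by rewrite ltn_subLR// addn3 ltnS.
  by have := src (Ordinal lt); rewrite /= subnKC.
have k0 : (tau <= tau <= tau.+2)%N by rewrite leqnn -addn2 leq_addr.
have k1 : (tau <= tau.+1 <= tau.+2)%N by rewrite !leqnSn.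
have k2 : (tau <= tau.+2 <= tau.+2)%N by rewrite leqnn -addn2 leq_addr.
have [e0 _ _] := src_n _ k0; have [e1 _ _] := src_n _ k1; have [e2 _ _] := src_n _ k2.
have dens b : density (law b) (obs_pdf beta p01 p11 e tau.+1 b).
  apply: (obs_has_density beta0 markov stat H01 H11 Hpa pa01 e0 e1 e2 _ _ indep).
  - by move=> n /src_n[].
  - by move=> n /src_n[].
have trans01 := trans_prob_itv H01 H11 Hpa pa01.
have agree_pdf z : agree (obs_pdf beta p01 p11 e tau.+1 true)
    (obs_pdf beta p01 p11 e tau.+1 false) z.
  exact: rules_agree_obs_pdf.
split.
  exists (obs_pdf beta p01 p11 e tau.+1 true), (obs_pdf beta p01 p11 e tau.+1 false).
  by split => //; exact: continuous_obs_pdf.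
move=> f1 f0 d1 d0.
have law_fin b : (law b setT < +oo)%E by rewrite /law /cond_law ltry.
have := has_density_ae_unique (law_fin true) d1 (dens true).
have := has_density_ae_unique (law_fin false) d0 (dens false).
(* Where both versions coincide with the explicit densities, so do the log-likelihood ratios. *)
apply: filterS2 => z f0E f1E.
by have := agree_pdf z; rewrite /agree /llr -f0E -f1E.
Qed.
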